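(* Let $\mathbb M$ be a class of totally ordered positively pointed Abelian $\ell$-groups. The following are equivalent: (1) $\mathbb M$ is a universal class; (2) there exist $I,J,K\subseteq\mathbb N$ and, for every $j\in J$, a nonempty set $D_j$ of divisors of $j$, such that $$\mathbb M=\mathbf{ISP_U}(\{\mathbf Z_i\mid i\in I\}\cup\{\mathbf Z_j\ltimes\mathbf Z_{d_j}\mid j\in J,\ d_j\in D_j\}\cup\{\mathbf S_k\mid k\in K\}).$$
   Context: A pointed Abelian $\ell$-group $\mathbf A_a$ is an Abelian $\ell$-group with a constant interpreted as $a$; positively pointed means $a\ge0$. $\mathbf Z_n$ denotes integers pointed at $n$. $\mathbf S$ is a fixed (arbitrary) finitely generated $\ell$-subgroup of the reals $\mathbf R$ which is dense in $\mathbb R$ and satisfies $S\cap\mathbb Q=\mathbb Z$, and $\mathbf S_k$ denotes $\mathbf S$ pointed at $k$. For totally ordered $\mathbf A$, $\mathbf A\ltimes\mathbf B$ is $A\times B$ with lexicographic order (first coordinate dominant); $\mathbf Z_j\ltimes\mathbf Z_d$ is pointed at $\langle j,d\rangle$. A class is universal if it is the class of all models of a set of universal sentences (equivalently, closed under isomorphisms, subalgebras and ultraproducts). $\mathbf{ISP_U}(\mathcal K)$ is the class of algebras isomorphic to subalgebras of ultrapowers of members of $\mathcal K$.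
   Formalization: Condition (1) also requires that if M contains a one-element algebra, it contains a nontrivial algebra pointed at 0 (the class of one-element algebras is otherwise a counterexample); ISP_U is taken with ultraproducts of possibly different members, not ultrapowers of single members. *)

(* Defs.v *)
From HB Require Import structures.
From mathcomp Require Import all_boot all_order all_algebra generic_quotient.
From mathcomp Require Import all_classical all_reals.
From mathcomp Require Import topology normedtype.

Set Implicit Arguments.
Unset Strict Implicit.
Unset Printing Implicit Defensive.

Import Order.TTheory GRing.Theory Num.Theory.
Import numFieldNormedType.Exports.

Local Open Scope classical_set_scope.
Local Open Scope ring_scope.
Local Open Scope quotient_scope.

(* Abelian l-groups, in the signature (0, +, -, meet, join).  The lattice     *)
(* operations are part of the mixin instead of coming from Order.Lattice:     *)
(* Num.RealDomain already inherits from both GRing.Zmodule and Order.Lattice, *)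
(* so Hierarchy Builder rejects another structure joining these two.          *)
HB.mixin Record isLGroup G of GRing.Zmodule G := {
  lmeet : G -> G -> G;
  ljoin : G -> G -> G;
  lmeetC : commutative lmeet;
  ljoinC : commutative ljoin;
  lmeetA : associative lmeet;
  ljoinA : associative ljoin;
  lmeetKU : forall x y, ljoin x (lmeet x y) = x;
  ljoinKI : forall x y, lmeet x (ljoin x y) = x;
  (* translations are monotone for the order of the lattice *)
  lleD2l : forall z x y, lmeet x y = x -> lmeet (z + x) (z + y) = z + x
}.

#[short(type="lGroupType")]
HB.structure Definition LGroup := { G of isLGroup G & GRing.Zmodule G }.

Definition lle (G : lGroupType) (x y : G) : bool := lmeet x y == x.

HB.mixin Record LGroup_isTotal G of LGroup G := {
  lle_total : total (@lle G)
}.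

#[short(type="totalLGroupType")]
HB.structure Definition TotalLGroup := { G of LGroup_isTotal G & LGroup G }.

Section LGroupTheory.
Variable G : lGroupType.
Implicit Types x y z : G.

Lemma lmeetxx x : lmeet x x = x.
Proof. by rewrite -[X in lmeet _ X](lmeetKU x x) ljoinKI. Qed.

Lemma ljoinxx x : ljoin x x = x.
Proof. by rewrite -[X in ljoin _ X](ljoinKI x x) lmeetKU. Qed.

Lemma lle_anti x y : lle x y -> lle y x -> x = y.
Proof. by move=> /eqP xy /eqP yx; rewrite -xy lmeetC yx. Qed.

Lemma lle_trans y x z : lle x y -> lle y z -> lle x z.
Proof. by move=> /eqP xy /eqP yz; apply/eqP; rewrite -xy -lmeetA yz. Qed.

Lemma lle_leD2l z x y : lle x y -> lle (z + x) (z + y).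
Proof. by move=> /eqP xy; apply/eqP/lleD2l. Qed.

Lemma lle_D2l z x y : lle (z + x) (z + y) = lle x y.
Proof.
apply/idP/idP; last exact: lle_leD2l.
by move=> /(lle_leD2l (- z)); rewrite !addKr.
Qed.

Lemma lle_joinE x y : lle x y = (ljoin x y == y).
Proof.
apply/eqP/eqP => [<-|<-]; last exact: ljoinKI.
by rewrite ljoinC lmeetC lmeetKU.
Qed.

Lemma lle_lmeet z x y : lle z (lmeet x y) = lle z x && lle z y.
Proof.
apply/idP/andP => [h|[/eqP zx /eqP zy]]; last by rewrite /lle lmeetA zx zy.
have h1 : lle (lmeet x y) x by rewrite /lle lmeetC lmeetA lmeetxx.
have h2 : lle (lmeet x y) y by rewrite /lle -lmeetA lmeetxx.
by split; apply: lle_trans h _.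
Qed.

Lemma lle_ljoin z x y : lle (ljoin x y) z = lle x z && lle y z.
Proof.
apply/idP/andP => [h|]; last first.
  by rewrite !lle_joinE => -[/eqP xz /eqP yz]; rewrite -ljoinA yz xz.
have h1 : lle x (ljoin x y) by rewrite /lle ljoinKI.
have h2 : lle y (ljoin x y) by rewrite /lle ljoinC ljoinKI.
by split; [apply: lle_trans h1 h|apply: lle_trans h2 h].
Qed.

End LGroupTheory.

Section RealDomainLGroup.
Variable R : realDomainType.
Implicit Types x y z : R.

Fact real_minKU x y : Num.max x (Num.min x y) = x.
Proof. by rewrite -meetEtotal -joinEtotal meetKU. Qed.

Fact real_maxKI x y : Num.min x (Num.max x y) = x.
Proof. by rewrite -meetEtotal -joinEtotal joinKI. Qed.

Fact real_minD2l z x y :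
  Num.min x y = x -> Num.min (z + x) (z + y) = z + x.
Proof. by rewrite -addr_minr => ->. Qed.

Fact real_min_total : total (fun x y => Num.min x y == x).
Proof.
by move=> x y; rewrite /= !eq_minl le_total.
Qed.

End RealDomainLGroup.

HB.instance Definition _ := isLGroup.Build int
  (@minC _ int) (@maxC _ int) (@minA _ int) (@maxA _ int)
  (@real_minKU int) (@real_maxKI int) (@real_minD2l int).
HB.instance Definition _ := LGroup_isTotal.Build int (@real_min_total int).

HB.instance Definition _ (R : realType) := isLGroup.Build R
  (@minC _ R) (@maxC _ R) (@minA _ R) (@maxA _ R)
  (@real_minKU R) (@real_maxKI R) (@real_minD2l R).
HB.instance Definition _ (R : realType) :=
  LGroup_isTotal.Build R (@real_min_total R).

Section LatticeOfOrder.
Variables (T : eqType) (le : rel T) (m j : T -> T -> T).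
Hypotheses (le_refl : reflexive le) (le_anti : antisymmetric le).
Hypothesis le_trans : transitive le.
Hypothesis le_m : forall z x y, le z (m x y) = le z x && le z y.
Hypothesis le_j : forall z x y, le (j x y) z = le x z && le y z.

Let eq_lower x y : (forall z, le z x = le z y) -> x = y.
Proof. by move=> e; apply: le_anti; rewrite e le_refl -e le_refl. Qed.

Let eq_upper x y : (forall z, le x z = le y z) -> x = y.
Proof. by move=> e; apply: le_anti; rewrite e le_refl -e le_refl. Qed.

Lemma infC : commutative m.
Proof. by move=> x y; apply: eq_lower => z; rewrite !le_m andbC. Qed.

Lemma supC : commutative j.
Proof. by move=> x y; apply: eq_upper => z; rewrite !le_j andbC. Qed.

Lemma infA : associative m.
Proof. by move=> x y t; apply: eq_lower => z; rewrite !le_m andbA. Qed.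

Lemma supA : associative j.
Proof. by move=> x y t; apply: eq_upper => z; rewrite !le_j andbA. Qed.

Lemma infKsup x y : j x (m x y) = x.
Proof.
apply: eq_upper => z; rewrite le_j andb_idr// => xz.
by apply: le_trans xz; have := le_refl (m x y); rewrite le_m => /andP[].
Qed.

Lemma supKinf x y : m x (j x y) = x.
Proof.
apply: eq_lower => z; rewrite le_m andb_idr// => zx.
by apply: (le_trans zx); have := le_refl (j x y); rewrite le_j => /andP[].
Qed.

Lemma inf_leE x y : (m x y == x) = le x y.
Proof.
apply/eqP/idP => [<-|xy].
  by have := le_refl (m x y); rewrite le_m => /andP[].
apply: eq_lower => z; rewrite le_m andb_idr// => zx; exact: le_trans zx xy.
Qed.

End LatticeOfOrder.

Section LexProduct.
Variables (A : totalLGroupType) (B : lGroupType).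

Definition lex : Type := (A * B)%type.
HB.instance Definition _ := GRing.Zmodule.on lex.

Implicit Types p q r : lex.

Definition lex_le p q :=
  if p.1 == q.1 then lle p.2 q.2 else lle p.1 q.1.
Definition lex_meet p q : lex :=
  if p.1 == q.1 then (p.1, lmeet p.2 q.2) else if lle p.1 q.1 then p else q.
Definition lex_join p q : lex :=
  if p.1 == q.1 then (p.1, ljoin p.2 q.2) else if lle p.1 q.1 then q else p.

Let lle_refl (G : lGroupType) (x : G) : lle x x.
Proof. by rewrite /lle lmeetxx. Qed.

Fact lex_le_refl : reflexive lex_le.
Proof. by move=> p; rewrite /lex_le eqxx lle_refl. Qed.

Fact lex_le_anti : antisymmetric lex_le.
Proof.
move=> [p1 p2] [q1 q2]; rewrite /lex_le/= [q1 == p1]eq_sym.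
have [->|n] := eqVneq p1 q1 => /andP[pq qp]; first by rewrite (lle_anti pq qp).
by rewrite (lle_anti pq qp) eqxx in n.
Qed.

Fact lex_le_trans : transitive lex_le.
Proof.
move=> [q1 q2] [p1 p2] [r1 r2]; rewrite /lex_le/=.
have [e|npq] := eqVneq p1 q1; have [e'|nqr] := eqVneq q1 r1.
- by rewrite e e' eqxx; exact: lle_trans.
- by rewrite e (negPf nqr).
- by rewrite -e' (negPf npq).
- move=> pq qr; have [e|n] := eqVneq p1 r1; last exact: lle_trans qr.
  by rewrite -e in qr nqr; rewrite (lle_anti pq qr) eqxx in npq.
Qed.

Let nlle (x y : A) : x != y -> lle x y = ~~ lle y x.
Proof.
move=> n; have := lle_total x y; case: (boolP (lle x y)) => [xy _|_ /= ->]//.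
by apply/esym/negP => yx; rewrite (lle_anti xy yx) eqxx in n.
Qed.

Fact lex_le_meet r p q : lex_le r (lex_meet p q) = lex_le r p && lex_le r q.
Proof.
have H s t : lex_le s t -> lex_le r s = lex_le r s && lex_le r t.
  by move=> st; rewrite andb_idr// => /lex_le_trans; apply.
rewrite /lex_meet; have [e|n] := eqVneq p.1 q.1.
  by rewrite /lex_le/= -e; case: ifP => _; rewrite ?andbb// lle_lmeet.
case: ifP => pq; first by apply: H; rewrite /lex_le (negPf n).
by rewrite andbC; apply: H; rewrite /lex_le eq_sym (negPf n) nlle ?pq// eq_sym.
Qed.

Fact lex_le_join r p q : lex_le (lex_join p q) r = lex_le p r && lex_le q r.
Proof.
have H s t : lex_le s t -> lex_le t r = lex_le t r && lex_le s r.
  by move=> st; rewrite andb_idr// => /(lex_le_trans st).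
rewrite /lex_join; have [e|n] := eqVneq p.1 q.1.
  by rewrite /lex_le/= -e; case: ifP => _; rewrite ?andbb// lle_ljoin.
case: ifP => pq; first by rewrite andbC; apply: H; rewrite /lex_le (negPf n).
by apply: H; rewrite /lex_le eq_sym (negPf n) nlle ?pq// eq_sym.
Qed.

Fact lex_leD2l r p q : lex_meet p q = p -> lex_meet (r + p) (r + q) = r + p.
Proof.
have E := inf_leE lex_le_refl lex_le_anti lex_le_trans lex_le_meet.
move=> /eqP; rewrite E => pq; apply/eqP; rewrite E; move: pq.
by rewrite /lex_le/= (inj_eq (addrI _)) !lle_D2l.
Qed.

HB.instance Definition _ := isLGroup.Build lex
  (infC lex_le_refl lex_le_anti lex_le_meet)
  (supC lex_le_refl lex_le_anti lex_le_join)
  (infA lex_le_refl lex_le_anti lex_le_meet)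
  (supA lex_le_refl lex_le_anti lex_le_join)
  (infKsup lex_le_refl lex_le_anti lex_le_trans lex_le_meet lex_le_join)
  (supKinf lex_le_refl lex_le_anti lex_le_trans lex_le_meet lex_le_join)
  lex_leD2l.

Lemma lle_lexE p q : lle p q = lex_le p q.
Proof. exact: (inf_leE lex_le_refl lex_le_anti lex_le_trans lex_le_meet). Qed.

End LexProduct.

Section LSubgroup.
Variable G : lGroupType.

Definition is_lsubgroup (H : set G) : Prop :=
  [/\ H 0, forall x, H x -> H (- x), forall x y, H x -> H y -> H (x + y),
      forall x y, H x -> H y -> H (lmeet x y) &
      forall x y, H x -> H y -> H (ljoin x y)].

Record lsubgroup := LSubgroup {
  lsubgroup_set :> set G;
  lsubgroupP : is_lsubgroup lsubgroup_set
}.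

Definition finitely_generated (H : lsubgroup) : Prop :=
  exists s : seq G, lsubgroup_set H = smallest is_lsubgroup [set` s].

Variable H : lsubgroup.

Let P : pred G := fun x => x \in (H : set G).
Definition lsub : Type := {x | P x}.
HB.instance Definition _ := SubChoice.on lsub.

Fact lsub_zmod_closed : zmod_closed P.
Proof.
case: (lsubgroupP H) => H0 HN HD _ _; split; first by rewrite unfold_in inE.
by move=> x y; rewrite !unfold_in !inE => Hx Hy; apply/HD/HN.
Qed.
HB.instance Definition _ :=
  GRing.SubChoice_isSubZmodule.Build G P lsub lsub_zmod_closed.

Fact lsub_lmeet_subproof (x y : lsub) : P (lmeet (val x) (val y)).
Proof.
case: (lsubgroupP H) => _ _ _ HM _.
by rewrite /P inE; apply: HM; apply: set_mem; apply: valP.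
Qed.
Definition lsub_lmeet (x y : lsub) : lsub :=
  exist P _ (lsub_lmeet_subproof x y).

Fact lsub_ljoin_subproof (x y : lsub) : P (ljoin (val x) (val y)).
Proof.
case: (lsubgroupP H) => _ _ _ _ HJ.
by rewrite /P inE; apply: HJ; apply: set_mem; apply: valP.
Qed.
Definition lsub_ljoin (x y : lsub) : lsub :=
  exist P _ (lsub_ljoin_subproof x y).

Fact lsub_lmeetC : commutative lsub_lmeet.
Proof. by move=> x y; apply: val_inj; rewrite /= lmeetC. Qed.
Fact lsub_ljoinC : commutative lsub_ljoin.
Proof. by move=> x y; apply: val_inj; rewrite /= ljoinC. Qed.
Fact lsub_lmeetA : associative lsub_lmeet.
Proof. by move=> x y z; apply: val_inj; rewrite /= lmeetA. Qed.
Fact lsub_ljoinA : associative lsub_ljoin.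
Proof. by move=> x y z; apply: val_inj; rewrite /= ljoinA. Qed.
Fact lsub_lmeetKU x y : lsub_ljoin x (lsub_lmeet x y) = x.
Proof. by apply: val_inj; rewrite /= lmeetKU. Qed.
Fact lsub_ljoinKI x y : lsub_lmeet x (lsub_ljoin x y) = x.
Proof. by apply: val_inj; rewrite /= ljoinKI. Qed.
Fact lsub_leD2l z x y :
  lsub_lmeet x y = x -> lsub_lmeet (z + x) (z + y) = z + x.
Proof.
move=> /(congr1 val)/= xy; apply: val_inj.
exact: lleD2l xy.
Qed.

HB.instance Definition _ := isLGroup.Build lsub lsub_lmeetC lsub_ljoinC
  lsub_lmeetA lsub_ljoinA lsub_lmeetKU lsub_ljoinKI lsub_leD2l.

End LSubgroup.

Section Ultraproduct.
Variables (I : Type) (F : set_system I) (FF : Filter F) (B : I -> lGroupType).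

Local Notation P := (forall i, B i).
Implicit Types f g h : P.

Definition ueq f g : bool := `[< \forall i \near F, f i = g i >].

Fact ueq_refl : reflexive ueq.
Proof. by move=> f; apply/asboolP; apply: nearW. Qed.

Fact ueq_sym : symmetric ueq.
Proof.
by move=> f g; apply: asbool_equiv_eq; split; apply: filterS => i ->.
Qed.

Fact ueq_trans : transitive ueq.
Proof.
move=> g f h /asboolP fg /asboolP gh; apply/asboolP.
by move: fg gh; apply: filterS2 => i ->.
Qed.

Canonical ueq_equiv := EquivRel ueq ueq_refl ueq_sym ueq_trans.

(* The reduced product modulo F, an ultraproduct when F is an ultrafilter. *)
Definition ultra : Type := {eq_quot ueq_equiv}.
HB.instance Definition _ := Choice.on ultra.
HB.instance Definition _ := EqQuotient.on ultra.

Implicit Types u v w : ultra.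
Definition ucls f : ultra := \pi f.

Lemma uclsP f g : ucls f = ucls g <-> \forall i \near F, f i = g i.
Proof. by split=> [/eqmodP/asboolP|fg]//; apply/eqmodP/asboolP. Qed.

Lemma ucls_repr u : ucls (repr u) = u. Proof. exact: reprK. Qed.

Lemma near_ucls f : \forall i \near F, repr (ucls f) i = f i.
Proof. by apply/uclsP; rewrite ucls_repr. Qed.

Lemma ucls_ind (Q : ultra -> Prop) : (forall f, Q (ucls f)) -> forall u, Q u.
Proof. by move=> Qcls u; rewrite -(ucls_repr u). Qed.

Definition ulift1 (op : forall i, B i -> B i) u :=
  ucls (fun i => op i (repr u i)).
Definition ulift2 (op : forall i, B i -> B i -> B i) u v :=
  ucls (fun i => op i (repr u i) (repr v i)).

Lemma ulift1E op f : ulift1 op (ucls f) = ucls (fun i => op i (f i)).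
Proof. by apply/uclsP; have := near_ucls f; apply: filterS => i ->. Qed.

Lemma ulift2E op f g :
  ulift2 op (ucls f) (ucls g) = ucls (fun i => op i (f i) (g i)).
Proof.
apply/uclsP; move: (near_ucls f) (near_ucls g).
by apply: filterS2 => i -> ->.
Qed.

Definition uzero : ultra := ucls (fun=> 0).
Definition uopp : ultra -> ultra := ulift1 (fun i x => - x).
Definition uadd : ultra -> ultra -> ultra := ulift2 (fun i x y => x + y).
Definition umeet : ultra -> ultra -> ultra := ulift2 (fun i => @lmeet (B i)).
Definition ujoin : ultra -> ultra -> ultra := ulift2 (fun i => @ljoin (B i)).

Local Ltac pointwise :=
  rewrite ?/uadd ?/uopp ?/umeet ?/ujoin ?/uzero ?ulift1E ?ulift2E;
  rewrite ?ulift1E ?ulift2E; rewrite ?ulift1E ?ulift2E;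
  apply/uclsP; apply: nearW => i /=.

Fact uaddA : associative uadd.
Proof. by do 3!elim/ucls_ind=> ?; pointwise; rewrite addrA. Qed.
Fact uaddC : commutative uadd.
Proof. by do 2!elim/ucls_ind=> ?; pointwise; rewrite addrC. Qed.
Fact uadd0 : left_id uzero uadd.
Proof. by elim/ucls_ind=> ?; pointwise; rewrite add0r. Qed.
Fact uaddN : left_inverse uzero uopp uadd.
Proof. by elim/ucls_ind=> ?; pointwise; rewrite addNr. Qed.

HB.instance Definition _ := GRing.isZmodule.Build ultra uaddA uaddC uadd0 uaddN.

Fact umeetC : commutative umeet.
Proof. by do 2!elim/ucls_ind=> ?; pointwise; rewrite lmeetC. Qed.
Fact ujoinC : commutative ujoin.
Proof. by do 2!elim/ucls_ind=> ?; pointwise; rewrite ljoinC. Qed.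
Fact umeetA : associative umeet.
Proof. by do 3!elim/ucls_ind=> ?; pointwise; rewrite lmeetA. Qed.
Fact ujoinA : associative ujoin.
Proof. by do 3!elim/ucls_ind=> ?; pointwise; rewrite ljoinA. Qed.
Fact umeetKU u v : ujoin u (umeet u v) = u.
Proof.
by elim/ucls_ind: u => ?; elim/ucls_ind: v => ?; pointwise; rewrite lmeetKU.
Qed.
Fact ujoinKI u v : umeet u (ujoin u v) = u.
Proof.
by elim/ucls_ind: u => ?; elim/ucls_ind: v => ?; pointwise; rewrite ljoinKI.
Qed.
Fact uleD2l w u v : umeet u v = u -> umeet (w + u) (w + v) = w + u.
Proof.
rewrite -[w + u]/(uadd w u) -[w + v]/(uadd w v).
elim/ucls_ind: u => f; elim/ucls_ind: v => g; elim/ucls_ind: w => h.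
rewrite /umeet /uadd !ulift2E => /uclsP fg; apply/uclsP.
by move: fg; apply: filterS => i; apply: lleD2l.
Qed.

HB.instance Definition _ := isLGroup.Build ultra
  umeetC ujoinC umeetA ujoinA umeetKU ujoinKI uleD2l.

End Ultraproduct.

Record plgroup := PLGroup { plg_sort :> lGroupType; plg_point : plg_sort }.

Definition totally_ordered (A : plgroup) : Prop :=
  forall x y : A, lle x y \/ lle y x.

Definition positively_pointed (A : plgroup) : Prop := lle 0 (plg_point A).

Definition trivial_alg (A : plgroup) : Prop := forall x : A, x = 0.

Definition plg_morphism (A B : plgroup) (h : A -> B) : Prop :=
  [/\ [/\ h 0 = 0, {morph h : x / - x} & {morph h : x y / x + y}],
      {morph h : x y / lmeet x y}, {morph h : x y / ljoin x y} &
      h (plg_point A) = plg_point B].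

Definition isomorphic (A B : plgroup) : Prop :=
  exists2 h : A -> B, plg_morphism h & bijective h.

Section SubPLGroup.
Variables (G : lGroupType) (H : lsubgroup G) (a : G) (Ha : (H : set G) a).

Definition sub_plgroup : plgroup :=
  @PLGroup (lsub H) (exist (fun x => x \in (H : set G)) a (mem_set Ha)).

End SubPLGroup.

Definition ultraproduct (I : Type) (F : set_system I) (FF : UltraFilter F)
  (B : I -> plgroup) : plgroup :=
  @PLGroup (ultra (_ : Filter F) B) (ucls _ (fun i => plg_point (B i))).

(* [set plgroup] would be a universe inconsistency. *)
Definition plclass : Type := plgroup -> Prop.

(* P_U is the class operator of ultraproducts: the factors B i of an          *)
(* ultraproduct may be different members of K.                                *)
Definition ISPU (K : plclass) : plclass := fun A =>
  exists (I : Type) (F : set_system I) (FF : UltraFilter F)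
      (B : I -> plgroup) (H : lsubgroup (ultraproduct FF B))
      (pH : (H : set _) (plg_point (ultraproduct FF B))),
    (forall i, K (B i)) /\ isomorphic A (sub_plgroup pH).

Inductive term : Type :=
| Var (n : nat)
| Pt
| Zero
| Opp (t : term)
| Add (t u : term)
| Meet (t u : term)
| Join (t u : term).

Inductive qf_formula : Type :=
| Eq (t u : term)
| Not (phi : qf_formula)
| And (phi psi : qf_formula)
| Or (phi psi : qf_formula).

Fixpoint eval (A : plgroup) (e : nat -> A) (t : term) : A :=
  match t with
  | Var n => e n
  | Pt => plg_point A
  | Zero => 0
  | Opp t => - eval e t
  | Add t u => eval e t + eval e u
  | Meet t u => lmeet (eval e t) (eval e u)
  | Join t u => ljoin (eval e t) (eval e u)
  end.

Fixpoint holds (A : plgroup) (e : nat -> A) (phi : qf_formula) : Prop :=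
  match phi with
  | Eq t u => eval e t = eval e u
  | Not phi => ~ holds e phi
  | And phi psi => holds e phi /\ holds e psi
  | Or phi psi => holds e phi \/ holds e psi
  end.

(* A universal sentence is represented by its quantifier-free matrix, all of  *)
(* whose variables are understood as universally quantified.                  *)
Definition satisfies (A : plgroup) (phi : qf_formula) : Prop :=
  forall e : nat -> A, holds e phi.

Definition universal_class (M : plclass) : Prop :=
  exists Sigma : set qf_formula,
    forall A, M A <-> forall phi, Sigma phi -> satisfies A phi.

(* A trivial algebra embeds in an ultraproduct of the generators below only   *)
(* if some generator is pointed at 0, and all generators are nontrivial.      *)
(* Hence a universal class which contains the trivial algebras but no         *)
(* nontrivial algebra pointed at 0, e.g. the class of the trivial algebras,   *)
(* is not generated by any of them.  This condition rules out exactly those   *)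
(* classes.                                                                   *)
Definition trivial_covered (M : plclass) : Prop :=
  (exists2 A, M A & trivial_alg A) ->
  exists A, [/\ M A, ~ trivial_alg A & plg_point A = 0].

Definition pointed_int (n : nat) : plgroup := @PLGroup int n%:Z.

Definition pointed_lex_int (j d : nat) : plgroup :=
  @PLGroup (lex int int) (j%:Z, d%:Z).

Section PointedReals.
Variables (R : realType) (S : lsubgroup R).
Hypothesis SQ :
  (S : set R) `&` range (@ratr R) = range (fun z : int => z%:~R).

Lemma lsubgroup_nat k : (S : set R) k%:R.
Proof.
suff [] : ((S : set R) `&` range (@ratr R)) k%:R by [].
by rewrite SQ; exists k%:Z => //; rewrite pmulrn.
Qed.

Definition pointed_reals (k : nat) : plgroup := sub_plgroup (lsubgroup_nat k).

End PointedReals.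

Definition generators (R : realType) (S : lsubgroup R)
    (SQ : (S : set R) `&` range (@ratr R) = range (fun z : int => z%:~R))
    (I J K : set nat) (D : nat -> set nat) : plclass := fun A =>
  [\/ exists2 i, I i & A = pointed_int i,
      exists j d, [/\ J j, D j d & A = pointed_lex_int j d] |
      exists2 k, K k & A = pointed_reals SQ k].

(* Main.v *)
(* Membership in ISP_U(K) is local: A lies in ISP_U(K) iff every finite part  *)
(* of A embeds in a member of K, and universal classes are closed under this. *)
(* For a totally ordered A, a finite part lies in the cone spanned over the   *)
(* naturals by finitely many positive, Z-independent elements b_i (Elliott:   *)
(* totally ordered Abelian groups are ultrasimplicial).  Any positive c_i in  *)
(* B then give a local embedding b_i |-> c_i; if a = sum alpha_i b_i is the   *)
(* point of A, it preserves the point when sum alpha_i c_i is that of B.      *)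
(* Let a > 0, g = gcd(alpha_i) and a = g e.  If a single alpha_i is nonzero,  *)
(* take Z_g.  If the archimedean component of a is dense modulo               *)
(* infinitesimals, Bezout and density solve sum alpha_i c_i = g in S and, the *)
(* other way around, show that S_g embeds locally in A.  Otherwise            *)
(* b_i = m_i v + infinitesimal for some v in A; with j = sum alpha_i m_i, A   *)
(* embeds locally in the lexicographic product Z_j x Z_g, which embeds in A.  *)

Require Import Defs.
From mathcomp Require Import all_boot all_order all_algebra.
From mathcomp Require Import all_classical all_reals.
From mathcomp Require Import topology normedtype.
From mathcomp Require Import zify ring.

Set Implicit Arguments.
Unset Strict Implicit.
Unset Printing Implicit Defensive.

Import Order.TTheory GRing.Theory Num.Theory.
Import numFieldNormedType.Exports.

Local Open Scope classical_set_scope.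
Local Open Scope ring_scope.

(* topology also exports an eval. *)
Local Notation eval := Defs.eval.

(** Both directions go through local embeddability. [ISPU K] is [locally_in K]: a finite part of a
    subalgebra of an ultraproduct is realized in one factor ([ISPU_locally_in]), and conversely
    local embeddings are glued along an ultrafilter on the finite lists of elements
    ([locally_in_ISPU]). Moreover [locally_in K] is axiomatized by the universal theory of [K]
    ([locally_in_universal]), so every class in (2) is universal.

    From (1) to (2), the generators are all those that lie in M. It has to be shown that each finite
    part of a member A of M embeds in a generator which in turn embeds locally in A, and hence lies
    in M ([locally_in_generators]).

    [ultrasimplicial_local_emb] reduces the first embedding to one linear equation: the finite part
    is controlled by independent positive b_i, the point a of A is sum alpha_i b_i, and positive c_i
    in B define a local embedding as soon as sum alpha_i c_i is the point of B. Dividing by g =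
    gcd(alpha_i) leaves coprime coefficients beta_i, for which Bezout gives integer solutions; the
    difficulty is positivity. In S it comes from density ([dense_at_solve]); in the lexicographic
    product, a coordinate with positive first component absorbs all corrections of the second
    component ([lex_solve]).

    The split is on [dense_point a]. If it holds, the same equation can be solved in A, so S_g
    embeds locally in A ([pointed_reals_emb]). Otherwise A has a unit v that is minimal up to
    infinitesimals ([unit_exists]), and below a everything is a multiple of v plus an infinitesimal
    ([nearest_multiple]). A single nonzero alpha_i then gives a copy of the integers; two of them
    give a positive infinitesimal, and with it a copy of a lexicographic product ([unit_adjust],
    [lex_positive]). *)

(** * Local embeddings and ultraproducts *)

Definition local_emb (A B : plgroup) (s : seq A) (h : A -> B) : Prop :=
  [/\ [/\ h 0 = 0, h (plg_point A) = plg_point B & {in s &, injective h}],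
      {in s, forall x, - x \in s -> h (- x) = - h x},
      {in s &, forall x y, x + y \in s -> h (x + y) = h x + h y},
      {in s &, forall x y,
         lmeet x y \in s -> h (lmeet x y) = lmeet (h x) (h y)} &
      {in s &, forall x y,
         ljoin x y \in s -> h (ljoin x y) = ljoin (h x) (h y)}].

Definition locally_in (K : plclass) : plclass := fun A =>
  forall s : seq A, exists (B : plgroup) (h : A -> B), K B /\ local_emb s h.

Lemma near_all_in (I : Type) (F : set_system I) (FF : Filter F) (T : eqType)
    (s : seq T) (P : T -> I -> Prop) :
  (forall x, \forall i \near F, P x i) ->
  \forall i \near F, {in s, forall x, P x i}.
Proof.
move=> nP; elim: s => [|x s IHs]; first by apply: nearW => i x.
move: (nP x) IHs; apply: filterS2 => i Px Ps y.
by rewrite inE => /predU1P[->//|]; apply: Ps.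
Qed.

(** Each required equation holds at almost all indices, and so does each inequation because F is an
    ultrafilter. As [s] is finite, some index satisfies all of them at once. *)
Lemma ISPU_locally_in (K : plclass) (A : plgroup) : ISPU K A -> locally_in K A.
Proof.
move=> [I [F [FF [B [H [pH [KB [g [[g0 gN gD] gM gJ gp] bg]]]]]]]] s.
pose f x i : B i := repr (val (g x)) i.
have fE x (v : forall i, B i) : val (g x) = ucls _ v ->
    \forall i \near F, f x i = v i.
  by rewrite /f => ->; apply: near_ucls.
have n0 : \forall i \near F, f 0 i = 0 by apply: fE; rewrite g0.
have np : \forall i \near F, f (plg_point A) i = plg_point (B i).
  by apply: fE; rewrite gp.
have nN x : \forall i \near F, f (- x) i = - f x i by apply: fE; rewrite gN.
have nD x y : \forall i \near F, f (x + y) i = f x i + f y i.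
  by apply: fE; rewrite gD.
have nM x y : \forall i \near F, f (lmeet x y) i = lmeet (f x i) (f y i).
  by apply: fE; rewrite gM.
have nJ x y : \forall i \near F, f (ljoin x y) i = ljoin (f x i) (f y i).
  by apply: fE; rewrite gJ.
have nI x y : \forall i \near F, f x i = f y i -> x = y.
  have [->|xy] := pselect (x = y); first exact: nearW.
  have [fxy|] := in_ultra_setVsetC [set i | f x i = f y i] FF.
    case: xy; apply: (bij_inj bg); apply: val_inj.
    by rewrite -(ucls_repr (val (g x))) -(ucls_repr (val (g y))); apply/uclsP.
  by apply: filterS => i nxy /nxy.
have all1 (P : A -> I -> Prop) (nP : forall x, \forall i \near F, P x i) :
    \forall i \near F, {in s, forall x, P x i} by exact: near_all_in.
have all2 (P : A -> A -> I -> Prop)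
    (nP : forall x y, \forall i \near F, P x y i) :
    \forall i \near F, {in s &, forall x y, P x y i}.
  have := all1 (fun x i => {in s, forall y, P x y i}) (fun x => all1 _ (nP x)).
  by apply: filterS => i Pi x y xs ys; exact: (Pi x xs y ys).
have [i [[[[[[h0 hp] hI] hN] hD] hM] hJ]] :=
  filter_ex (filterI (filterI (filterI (filterI (filterI (filterI n0 np)
    (all2 _ nI)) (all1 _ nN)) (all2 _ nD)) (all2 _ nM)) (all2 _ nJ)).
exists (B i), (fun x => f x i); split=> //; split=> //.
- by move=> x xs _; apply: hN.
- by move=> x y xs ys _; apply: hD.
- by move=> x y xs ys _; apply: hM.
- by move=> x y xs ys _; apply: hJ.
Qed.

(** The index set is the set of finite lists in A, with an ultrafilter containing, for each [s], the
    set of lists that include [s]. Any given instance of an operation is then respected at almost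
    all indices. *)
Lemma locally_in_ISPU (K : plclass) (A : plgroup) : locally_in K A -> ISPU K A.
Proof.
move=> locA.
pose c1 s := cid (locA s); pose c2 s := cid (projT2 (c1 s)).
pose B s := projT1 (c1 s); pose h s : A -> B s := projT1 (c2 s).
have KB s : K (B s) := (projT2 (c2 s)).1.
have hE s : local_emb s (h s) := (projT2 (c2 s)).2.
pose F0 : set_system (seq A) :=
  [set X | exists s : seq A, forall t : seq A, {subset s <= t} -> X t].
have F0P : ProperFilter F0.
  split; first by move=> [s /(_ s)]; apply.
  split.
  - by exists [::].
  - move=> X Y [s Xs] [t Yt]; exists (s ++ t) => r str.
    by split; [apply: Xs|apply: Yt] => x xst;
      apply: str; rewrite mem_cat xst ?orbT.
  - by move=> X Y XY [s Xs]; exists s => t /Xs /XY.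
have [F [FF F0F]] := ultraFilterLemma F0P.
have nin (l : seq A) : \forall s \near F, {subset l <= s}.
  by apply: F0F; exists l.
pose U := ultraproduct FF B.
pose g (x : A) : U := ucls _ (fun s => h s x).
have gI : injective g.
  move=> x y /uclsP e.
  have [s [xys hxy]] := filter_ex (filterI (nin [:: x; y]) e).
  have [[_ _ + _] _ _ _] := hE s; apply; last exact: hxy.
    by apply: xys; rewrite inE eqxx.
  by apply: xys; rewrite !inE eqxx orbT.
have g0 : g 0 = 0 by apply/uclsP; apply: nearW => s; have [[]] := hE s.
have gp : g (plg_point A) = plg_point U.
  by apply/uclsP; apply: nearW => s; have [[]] := hE s.
have gN x : g (- x) = - g x.
  rewrite -[RHS]/(uopp _) /uopp ulift1E; apply/uclsP.
  have := nin [:: x; - x]; apply: filterS => s xs.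
  by have [_ -> //] := hE s; apply: xs; rewrite !inE eqxx ?orbT.
have gD x y : g (x + y) = g x + g y.
  rewrite -[RHS]/(uadd _ _) /uadd ulift2E; apply/uclsP.
  have := nin [:: x; y; x + y]; apply: filterS => s xs.
  by have [_ _ -> //] := hE s; apply: xs; rewrite !inE eqxx ?orbT.
have gM x y : g (lmeet x y) = lmeet (g x) (g y).
  rewrite -[RHS]/(umeet _ _) /umeet ulift2E; apply/uclsP.
  have := nin [:: x; y; lmeet x y]; apply: filterS => s xs.
  by have [_ _ _ -> //] := hE s; apply: xs; rewrite !inE eqxx ?orbT.
have gJ x y : g (ljoin x y) = ljoin (g x) (g y).
  rewrite -[RHS]/(ujoin _ _) /ujoin ulift2E; apply/uclsP.
  have := nin [:: x; y; ljoin x y]; apply: filterS => s xs.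
  by have [_ _ _ _ -> //] := hE s; apply: xs; rewrite !inE eqxx ?orbT.
have Hsub : is_lsubgroup (range g).
  split.
  - by exists 0.
  - by move=> _ [x _ <-]; exists (- x).
  - by move=> _ _ [x _ <-] [y _ <-]; exists (x + y).
  - by move=> _ _ [x _ <-] [y _ <-]; exists (lmeet x y).
  - by move=> _ _ [x _ <-] [y _ <-]; exists (ljoin x y).
pose H := LSubgroup Hsub.
have pH : (H : set U) (plg_point U) by exists (plg_point A).
exists (seq A), F, FF, B, H, pH; split=> //.
have gin x : g x \in (H : set U) by apply/mem_set; exists x.
exists (fun x => exist (fun u => u \in (H : set U)) (g x) (gin x)).
  split; first split.
  - exact: val_inj.
  - by move=> x; apply: val_inj; rewrite /= gN.
  - by move=> x y; apply: val_inj; rewrite /= gD.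
  - by move=> x y; apply: val_inj; rewrite /= gM.
  - by move=> x y; apply: val_inj; rewrite /= gJ.
  - exact: val_inj.
rewrite -setTT_bijective; split=> //.
  by move=> x y _ _ /(congr1 val) /gI.
move=> [u uH] _; have [x _ gx] := set_mem uH.
by exists x => //; apply: val_inj.
Qed.

(** * Universal sentences and finite diagrams *)

(** The values of all subterms are collected: a map that is a local embedding on this list commutes
    with the evaluation of the whole term. *)
Fixpoint term_values (A : plgroup) (e : nat -> A) (t : term) : seq A :=
  eval e t :: match t with
  | Var _ | Pt | Zero => [::]
  | Opp t => term_values e t
  | Add t u | Meet t u | Join t u => term_values e t ++ term_values e u
  end.

Fixpoint formula_values (A : plgroup) (e : nat -> A) (phi : qf_formula) :
    seq A :=
  match phi with
  | Eq t u => term_values e t ++ term_values e u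
  | Not phi => formula_values e phi
  | And phi psi | Or phi psi => formula_values e phi ++ formula_values e psi
  end.

Lemma eval_in (A : plgroup) (e : nat -> A) (t : term) (s : seq A) :
  {subset term_values e t <= s} -> eval e t \in s.
Proof. by move=> /(_ (eval e t)); apply; case: t => *; apply: mem_head. Qed.

Lemma eval_local_emb (A B : plgroup) (s : seq A) (h : A -> B) (e : nat -> A)
    (t : term) : local_emb s h -> {subset term_values e t <= s} ->
  eval (h \o e) t = h (eval e t).
Proof.
move=> [[h0 hp _] hN hD hM hJ].
elim: t => [n|||t IHt|t IHt u IHu|t IHt u IHu|t IHt u IHu] //= sub.
- have ts : {subset term_values e t <= s}.
    by move=> x xt; apply: sub; rewrite inE xt orbT.
  by rewrite IHt// hN// ?eval_in//; apply: sub; apply: mem_head.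
all: have ts : {subset term_values e t <= s}
  by move=> x xt; apply: sub; rewrite inE mem_cat xt !orbT.
all: have us : {subset term_values e u <= s}
  by move=> x xt; apply: sub; rewrite inE mem_cat xt !orbT.
all: have := sub _ (mem_head _ _) => vs.
all: by rewrite IHt// IHu// (hD, hM, hJ)// eval_in.
Qed.

Lemma holds_local_emb (A B : plgroup) (s : seq A) (h : A -> B) (e : nat -> A)
    (phi : qf_formula) : local_emb s h -> {subset formula_values e phi <= s} ->
  holds (h \o e) phi <-> holds e phi.
Proof.
move=> hE; have [[_ _ hI] _ _ _ _] := hE.
have catl (l r : seq A) : {subset l ++ r <= s} -> {subset l <= s}.
  by move=> sub x xl; apply: sub; rewrite mem_cat xl.
have catr (l r : seq A) : {subset l ++ r <= s} -> {subset r <= s}.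
  by move=> sub x xl; apply: sub; rewrite mem_cat xl orbT.
elim: phi => [t u|phi IH|phi IH psi IH'|phi IH psi IH'] /= sub.
- rewrite !(eval_local_emb hE) ?(catl _ _ sub, catr _ _ sub)//; last 2 first.
  + exact: catr sub.
  + exact: catl sub.
  split=> [|->//]; apply: hI; first exact/eval_in/(catl _ _ sub).
  exact/eval_in/(catr _ _ sub).
- by rewrite IH.
- by rewrite IH ?IH'//; [apply: catr sub|apply: catl sub].
- by rewrite IH ?IH'//; [apply: catr sub|apply: catl sub].
Qed.

Lemma locally_in_satisfies (K : plclass) (A : plgroup) (phi : qf_formula) :
  locally_in K A -> (forall B, K B -> satisfies B phi) -> satisfies A phi.
Proof.
move=> locA Kphi e; have [B [h [KB hE]]] := locA (formula_values e phi).
by apply/(holds_local_emb hE); [move=> x|apply: Kphi].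
Qed.

Lemma universal_class_locally_in (M : plclass) (A : plgroup) :
  universal_class M -> locally_in M A -> M A.
Proof.
move=> [Sigma MS] locA; apply/MS => phi Sphi.
by apply: locally_in_satisfies locA _ => B /MS; apply.
Qed.

Definition conjunction (T : Type) (F : T -> qf_formula) (l : seq T) :=
  foldr (fun x => And (F x)) (Eq Zero Zero) l.

Lemma holds_conjunction (A : plgroup) (e : nat -> A) (T : eqType)
    (F : T -> qf_formula) (l : seq T) :
  holds e (conjunction F l) <-> {in l, forall x, holds e (F x)}.
Proof.
elim: l => [|y l IHl] /=; first by split.
rewrite IHl; split=> [[Fy Fl] x|Fl].
  by rewrite inE => /predU1P[->//|]; apply: Fl.
split; first by apply: Fl; apply: mem_head.
by move=> x xl; apply: Fl; rewrite inE xl orbT.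
Qed.

Definition literal (A : plgroup) (e : nat -> A) (phi : qf_formula) :=
  if `[< holds e phi >] then phi else Not phi.

Lemma holds_literal (A : plgroup) (e : nat -> A) (phi : qf_formula) :
  holds e (literal e phi).
Proof. by rewrite /literal; case: asboolP. Qed.

Lemma literalP (A B : plgroup) (e : nat -> A) (e' : nat -> B)
    (phi : qf_formula) :
  holds e' (literal e phi) -> (holds e' phi <-> holds e phi).
Proof. by rewrite /literal; case: asboolP => ? /= ?; split. Qed.

Definition diagram_atoms (x y z : nat) : seq qf_formula :=
  [:: Eq Zero (Var x); Eq Pt (Var x); Eq (Var x) (Var y);
      Eq (Opp (Var x)) (Var y); Eq (Add (Var x) (Var y)) (Var z);
      Eq (Meet (Var x) (Var y)) (Var z); Eq (Join (Var x) (Var y)) (Var z)].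

(** The atomic diagram of the first [n] values of [e]. A valuation satisfying it in B yields a local
    embedding of these values. *)
Definition diagram (A : plgroup) (e : nat -> A) (n : nat) : qf_formula :=
  let vs := iota 0 n in
  conjunction (fun x => conjunction (fun y => conjunction (fun z =>
    conjunction
      (fun k => literal e (nth (Eq Zero Zero) (diagram_atoms x y z) k))
      (iota 0 7)) vs) vs) vs.

Lemma holds_diagram (A : plgroup) (e : nat -> A) (n : nat) :
  holds e (diagram e n).
Proof. by do 4!apply/holds_conjunction => ? _; apply: holds_literal. Qed.

Lemma diagramP (A B : plgroup) (e : nat -> A) (e' : nat -> B)
    (n x y z k : nat) :
  holds e' (diagram e n) -> (x < n)%N -> (y < n)%N -> (z < n)%N -> (k < 7)%N ->
  let phi := nth (Eq Zero Zero) (diagram_atoms x y z) k in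
  holds e' phi <-> holds e phi.
Proof.
move=> d xn yn zn kn /=; apply: literalP.
move: d => /holds_conjunction/(_ x); rewrite mem_iota => /(_ xn).
move=> /holds_conjunction/(_ y); rewrite mem_iota => /(_ yn).
move=> /holds_conjunction/(_ z); rewrite mem_iota => /(_ zn).
by move=> /holds_conjunction/(_ k); rewrite mem_iota => /(_ kn).
Qed.

(** The axioms are all universal sentences true in [K]. If a finite part of A embedded in no member
    of [K], the negation of its diagram would be such a sentence, but it fails in A. *)
Lemma locally_in_universal (K : plclass) : universal_class (locally_in K).
Proof.
exists [set phi | forall B, K B -> satisfies B phi] => A; split.
  by move=> locA phi; apply: locally_in_satisfies.
move=> AK s; pose s' := [:: 0, plg_point A & s].
pose e (n : nat) : A := nth 0 s' n.
have [B [KB [e' d]]] : exists B, K B /\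
    exists e' : nat -> B, holds e' (diagram e (size s')).
  apply: contrapT => noB; suff: satisfies A (Not (diagram e (size s'))).
    by move=> /(_ e) nd; have /nd := holds_diagram e (size s').
  by apply: AK => B KB e' d; apply: noB; exists B; split=> //; exists e'.
pose v x := index x s'.
have vlt x : x \in s' -> (v x < size s')%N by rewrite index_mem.
have ev x : x \in s' -> e (v x) = x by apply: nth_index.
have in0 : 0 \in s' by apply: mem_head.
have inp : plg_point A \in s' by rewrite !inE eqxx orbT.
have ins x : x \in s -> x \in s' by rewrite !inE => ->; rewrite !orbT.
exists B, (e' \o v); split=> //; split; first split.
- apply/esym/(diagramP (y := v 0) (z := v 0) (k := 0) d (vlt _ in0))=> //=.
  + exact: vlt.
  + exact: vlt.
  + by rewrite ev.
- apply/esym/(diagramP (y := v 0) (z := v 0) (k := 1) d (vlt _ inp))=> //=.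
  + exact: vlt.
  + exact: vlt.
  + by rewrite ev.
- move=> x y /ins xs /ins ys.
  have /(_ isT) /= := diagramP (k := 2) d (vlt _ xs) (vlt _ ys) (vlt _ in0).
  by rewrite !ev//= => -> .
- move=> x /ins xs /ins ys; apply/esym.
  have /(_ isT) /= := diagramP (k := 3) d (vlt _ xs) (vlt _ ys) (vlt _ in0).
  by rewrite !ev//= => ->.
- move=> x y /ins xs /ins ys /ins zs; apply/esym.
  have /(_ isT) /= := diagramP (k := 4) d (vlt _ xs) (vlt _ ys) (vlt _ zs).
  by rewrite !ev//= => ->.
- move=> x y /ins xs /ins ys /ins zs; apply/esym.
  have /(_ isT) /= := diagramP (k := 5) d (vlt _ xs) (vlt _ ys) (vlt _ zs).
  by rewrite !ev//= => ->.
- move=> x y /ins xs /ins ys /ins zs; apply/esym.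
  have /(_ isT) /= := diagramP (k := 6) d (vlt _ xs) (vlt _ ys) (vlt _ zs).
  by rewrite !ev//= => ->.
Qed.

(** * Linear identities in abelian groups by reflection *)

Inductive zexpr : Type :=
| ZVar (n : nat)
| ZZero
| ZOpp (e : zexpr)
| ZAdd (e f : zexpr)
| ZMuln (e : zexpr) (n : nat)
| ZMulz (e : zexpr) (n : int).

Fixpoint zeval (V : zmodType) (env : seq V) (e : zexpr) : V :=
  match e with
  | ZVar n => nth 0 env n
  | ZZero => 0
  | ZOpp e => - zeval env e
  | ZAdd e f => zeval env e + zeval env f
  | ZMuln e n => zeval env e *+ n
  | ZMulz e n => zeval env e *~ n
  end.

Fixpoint zcoef (e : zexpr) (i : nat) : int :=
  match e with
  | ZVar n => if Nat.eqb n i then 1 else 0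
  | ZZero => 0
  | ZOpp e => - zcoef e i
  | ZAdd e f => zcoef e i + zcoef f i
  | ZMuln e n => zcoef e i * n%:Z
  | ZMulz e n => zcoef e i * n
  end.

(** Recursion on [n] lets simplification unfold this into one integer identity per variable. *)
Fixpoint zcoef_eq (e f : zexpr) (n : nat) : Prop :=
  if n is n'.+1 then zcoef e n' = zcoef f n' /\ zcoef_eq e f n' else True.

Lemma zeval_coef (V : zmodType) (env : seq V) (e : zexpr) :
  zeval env e = \sum_(i < size env) env`_i *~ zcoef e i.
Proof.
elim: e => [n||e IHe|e IHe f IHf|e IHe n|e IHe n] /=.
- have nE i : Nat.eqb n i = (n == i) by elim: n i => [|n IHn] [|i] //=.
  have [ns|sn] := ltnP n (size env); last first.
    rewrite nth_default// big1// => i _; rewrite nE.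
    by case: eqP => // e; have := ltn_ord i; rewrite -e ltnNge sn.
  rewrite (bigD1 (Ordinal ns))//= nE eqxx mulr1z big1 ?addr0// => i.
  by rewrite nE -(inj_eq val_inj)/= eq_sym => /negPf ->.
- by rewrite big1// => i _.
- by rewrite IHe -sumrN; apply: eq_bigr => i _; rewrite mulrNz.
- by rewrite IHe IHf -big_split; apply: eq_bigr => i _; rewrite /= mulrzDr.
- by rewrite IHe -sumrMnl; apply: eq_bigr => i _; rewrite mulrzA pmulrn.
- by rewrite IHe mulrz_suml; apply: eq_bigr => i _; rewrite mulrzA.
Qed.

Lemma zmod_eq (V : zmodType) (env : seq V) (e f : zexpr) :
  zcoef_eq e f (size env) -> zeval env e = zeval env f.
Proof.
move=> ef; rewrite !zeval_coef; apply: eq_bigr => i _; congr (_ *~ _).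
elim: (size env) ef i => [|n IHn] /= => [_ []//|[efn /IHn ef] i].
have := ltn_ord i; rewrite ltnS leq_eqVlt => /predU1P[->//|lt_in].
exact: (ef (Ordinal lt_in)).
Qed.

Ltac zvars t env :=
  lazymatch t with
  | (?a + ?b)%R => let env := zvars a env in zvars b env
  | (- ?a)%R => zvars a env
  | (?a *+ _)%R => zvars a env
  | (?a *~ _)%R => zvars a env
  | 0%R => env
  | ?x => lazymatch env with
          | context [x :: _] => env
          | _ => constr:(x :: env)
          end
  end.

Ltac zindex x env :=
  lazymatch env with
  | x :: _ => constr:(O)
  | _ :: ?env => let n := zindex x env in constr:(S n)
  end.

Ltac zreify t env :=
  lazymatch t with
  | (?a + ?b)%R =>
      let a := zreify a env in let b := zreify b env in constr:(ZAdd a b)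
  | (- ?a)%R => let a := zreify a env in constr:(ZOpp a)
  | (?a *+ ?n)%R => let a := zreify a env in constr:(ZMuln a n)
  | (?a *~ ?n)%R => let a := zreify a env in constr:(ZMulz a n)
  | 0%R => constr:(ZZero)
  | ?x => let n := zindex x env in constr:(ZVar n)
  end.

(* Proves identities between linear combinations in an abelian group, by      *)
(* [ring] in int on the coefficients.                                         *)
Ltac zmodule :=
  lazymatch goal with
  | |- @eq ?V ?a ?b =>
      let env := zvars a (@nil V) in let env := zvars b env in
      let e := zreify a env in let f := zreify b env in
      refine (@zmod_eq _ env e f _); rewrite /=; do ?split;
      try first [ring | lia]
  end.

(** * Strictly positive elements *)

Section Positive.
Variable G : lGroupType.
Implicit Types x y z : G.

Definition lpos x := lle 0 x && (x != 0).

Lemma lle_refl x : lle x x. Proof. by rewrite /lle lmeetxx. Qed.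

Lemma lle_subr x y : lle 0 (y - x) = lle x y.
Proof. by rewrite -(lle_D2l x) addr0 addrCA subrr addr0. Qed.

Lemma lposW x : lpos x -> lle 0 x. Proof. by case/andP. Qed.

Lemma lnnegD x y : lle 0 x -> lle 0 y -> lle 0 (x + y).
Proof.
by move=> x0 y0; apply: lle_trans x0 _; rewrite -{1}[x]addr0 lle_D2l.
Qed.

Lemma lposDl x y : lpos x -> lle 0 y -> lpos (x + y).
Proof.
move=> /andP[x0 nx0] y0; apply/andP; split; first exact: lnnegD.
apply: contra nx0 => /eqP xy0; apply/eqP/(lle_anti _ x0).
by rewrite -xy0 -{1}[x]addr0 lle_D2l.
Qed.

Lemma lposDr x y : lle 0 x -> lpos y -> lpos (x + y).
Proof. by move=> x0 y0; rewrite addrC; apply: lposDl. Qed.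

Lemma lposD x y : lpos x -> lpos y -> lpos (x + y).
Proof. by move=> x0 /lposW; apply: lposDl. Qed.

Lemma lnnegMn x n : lle 0 x -> lle 0 (x *+ n).
Proof.
move=> x0; elim: n => [|n IHn]; first by rewrite mulr0n lle_refl.
by rewrite mulrS lnnegD.
Qed.

Lemma lposMn x n : lpos x -> (0 < n)%N -> lpos (x *+ n).
Proof. by case: n => // n x0 _; rewrite mulrS lposDl// lnnegMn// lposW. Qed.

Lemma lposNF x : lpos x -> lle x 0 -> False.
Proof. by move=> /andP[x0 /eqP nx0] x0'; apply: nx0; apply: lle_anti. Qed.

Lemma lpos_sum (T : finType) (D : pred T) (F : T -> G) (i : T) :
  (forall i, i \in D -> lle 0 (F i)) -> i \in D -> lpos (F i) ->
  lpos (\sum_(i in D) F i).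
Proof.
move=> F0 iD Fi; rewrite (bigD1 i)//=; apply: lposDl => //.
by elim/big_ind: _ => //; [exact: lle_refl|exact: lnnegD|move=> j /andP[/F0]].
Qed.

Hypothesis total : forall x y, lle x y \/ lle y x.

Lemma lpos_trichotomy x : [\/ x = 0, lpos x | lpos (- x)].
Proof.
have [->|nx] := eqVneq x 0; first by constructor 1.
have [x0|x0] := total 0 x; first by constructor 2; rewrite /lpos x0.
by constructor 3; rewrite /lpos oppr_eq0 nx andbT -[- x]add0r lle_subr.
Qed.

Lemma lposMn_inv x n : lpos (x *+ n) -> lpos x.
Proof.
move=> xn; have [x0|//|x0] := lpos_trichotomy x.
  by move: xn; rewrite x0 mul0rn /lpos eqxx andbF.
case: (lposNF xn); rewrite -lle_subr sub0r -mulNrn; exact/lnnegMn/lposW.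
Qed.

Lemma lposPn x : ~~ lpos x <-> lle x 0.
Proof.
split=> [|x0]; last by apply/negP => /lposNF; apply.
have [->|->//|] := lpos_trichotomy x; first by rewrite lle_refl.
by move=> /lposW; rewrite -sub0r lle_subr.
Qed.

End Positive.

(** * Totally ordered abelian groups are ultrasimplicial *)

Section Ultrasimplicial.
Variables (G : lGroupType) (T : finType).
Hypothesis total : forall x y : G, lle x y \/ lle y x.
Implicit Types (D : pred T) (b : T -> G) (kappa : T -> int).

Definition nat_comb D b (x : G) :=
  exists k : T -> nat, x = \sum_(i in D) b i *+ k i.

Lemma nat_comb_gen D b i : i \in D -> nat_comb D b (b i).
Proof.
move=> iD; exists (fun j => (j == i) : nat).
rewrite (bigD1 i)//= eqxx mulr1n big1 ?addr0// => j /andP[_ /negPf ->].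
exact: mulr0n.
Qed.

Lemma nat_comb0 D b : nat_comb D b 0.
Proof. by exists (fun=> 0%N); rewrite big1. Qed.

Lemma nat_combD D b x y :
  nat_comb D b x -> nat_comb D b y -> nat_comb D b (x + y).
Proof.
move=> [k ->] [l ->]; exists (fun i => (k i + l i)%N).
by rewrite -big_split; apply: eq_bigr => i _; rewrite /= mulrnDr.
Qed.

Lemma nat_comb_trans D D' b b' x :
  (forall i, i \in D -> nat_comb D' b' (b i)) ->
  nat_comb D b x -> nat_comb D' b' x.
Proof.
move=> bb' [k ->]; elim/big_ind: _ => [||i iD]; first exact: nat_comb0.
  by move=> *; apply: nat_combD.
elim: (k i) => [|n IHn]; first by rewrite mulr0n; apply: nat_comb0.
by rewrite mulrS; apply: nat_combD => //; apply: bb'.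
Qed.

Definition relation D b kappa := \sum_(i in D) b i *~ kappa i = 0.

Definition independent D b :=
  forall kappa, relation D b kappa -> forall i, i \in D -> kappa i = 0.

Definition positive_on D b := forall i, i \in D -> lpos (b i).

Definition reducible D b := exists D' b', [/\ (#|D'| < #|D|)%N,
  positive_on D' b' & forall i, i \in D -> nat_comb D' b' (b i)].

Lemma reducible_eq D b i j : positive_on D b -> i \in D -> j \in D -> i != j ->
  b i = b j -> reducible D b.
Proof.
move=> bpos iD jD ij bij; exists [predD1 D & j], b; split.
- by rewrite [ltnRHS](cardD1 j) jD.
- by move=> k /andP[_ /bpos].
- move=> k kD; have [->|kj] := eqVneq k j.
    by rewrite -bij; apply: nat_comb_gen; rewrite !inE ij.
  by apply: nat_comb_gen; rewrite !inE kj.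
Qed.

Definition subtract b i j k := if k == j then b j - b i else b k.

(** The coefficients of a relation after [subtract], by k_i b_i + k_j b_j = (k_i + k_j) b_i + k_j
    (b_j - b_i). *)
Definition transfer kappa i j k :=
  if k == i then kappa i + kappa j else kappa k.

Lemma subtract_relation D b kappa i j : i \in D -> j \in D -> i != j ->
  relation D b kappa -> relation D (subtract b i j) (transfer kappa i j).
Proof.
move=> iD jD ij; rewrite /relation => rel; rewrite -[RHS]rel.
have jD' : (j \in D) && (j != i) by rewrite jD eq_sym.
rewrite (bigD1 i)//= [RHS](bigD1 i)//= (bigD1 j)//= [in RHS](bigD1 j)//=.
rewrite /subtract /transfer !eqxx (negPf ij) eq_sym (negPf ij) !addrA.
congr (_ + _); first by zmodule.
by apply: eq_bigr => k /andP[/andP[_ /negPf ->] /negPf ->].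
Qed.

Lemma subtract_positive D b i j :
  positive_on D b -> lpos (b j - b i) -> positive_on D (subtract b i j).
Proof.
by move=> bpos bij k kD; rewrite /subtract; case: eqP => // _; apply: bpos.
Qed.

Lemma subtract_nat_comb D b i j k : i \in D -> j \in D -> i != j -> k \in D ->
  nat_comb D (subtract b i j) (b k).
Proof.
move=> iD jD ij kD; have gen l := @nat_comb_gen D (subtract b i j) l.
have [->|kj] := eqVneq k j.
  have -> : b j = subtract b i j j + subtract b i j i.
    by rewrite /subtract eqxx (negPf ij) subrK.
  by apply: nat_combD; apply: gen.
by have := gen k kD; rewrite /subtract (negPf kj).
Qed.

Lemma reducible_trans D b b' :
  (forall i, i \in D -> nat_comb D b' (b i)) -> reducible D b' -> reducible D b.
Proof.
move=> bb' [D' [b'' [lt pos comb]]]; exists D', b''; split=> // i /bb'.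
exact: nat_comb_trans.
Qed.

(** Without a negative coefficient the relation would be a strictly positive sum. *)
Lemma relation_neg D b kappa i : positive_on D b -> relation D b kappa ->
  i \in D -> 0 < kappa i -> exists2 j, j \in D & kappa j < 0.
Proof.
move=> bpos rel iD ki; apply: contrapT => noj.
have kge j : j \in D -> 0 <= kappa j.
  by move=> jD; rewrite leNgt; apply/negP => kj; apply: noj; exists j.
suff : lpos (\sum_(i in D) b i *~ kappa i).
  by rewrite [X in lpos X]rel /lpos eqxx andbF.
apply: (lpos_sum (i := i)) => // [j jD|].
  by case: (kappa j) (kge j jD) => // n _; apply/lnnegMn/lposW/bpos.
by case: (kappa i) ki => // n n0; apply: lposMn => //; apply: bpos.
Qed.

(* Lexicographic descent on (K, number of indices with |kappa| = K, number of *)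
(* negative coefficients): with kappa i = K and kappa j < 0, subtract the     *)
(* smaller of b i, b j from the other one.                                    *)
Lemma relation_reducible D (K c : nat) b kappa : positive_on D b ->
  relation D b kappa -> (exists2 i, i \in D & kappa i != 0) ->
  (forall i, i \in D -> (absz (kappa i) <= K)%N) ->
  (#|[pred i in D | absz (kappa i) == K]| <= c)%N -> reducible D b.
Proof.
elim: K c b kappa => [|K IHK] c b kappa.
  move=> _ _ [i iD ki] kK _; case/negP: ki.
  by rewrite -absz_eq0 -leqn0 kK.
elim: c b kappa => [|c IHc] b kappa bpos rel nz kK cnt.
  apply: (IHK #|D| b kappa) => // [i iD|]; last first.
    by apply: subset_leq_card; apply/fintype.subsetP => i /andP[].
  have := kK i iD; rewrite leq_eqVlt ltnS => /predU1P[ki|//].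
  move: cnt; rewrite leqn0 => /eqP/card0_eq/(_ i).
  by rewrite !inE iD ki eqxx.
have [[i0 i0D ki0]|noi] :=
  pselect (exists2 i, i \in D & absz (kappa i) = K.+1); last first.
  apply: (IHK #|D| b kappa) => // [i iD|]; last first.
    by apply: subset_leq_card; apply/fintype.subsetP => i /andP[].
  have := kK i iD; rewrite leq_eqVlt ltnS => /predU1P[ki|//].
  by case: noi; exists i.
wlog ki0' : kappa rel nz kK cnt ki0 / kappa i0 = K.+1%:Z.
  move=> wl; have [k0|k0] := leP 0 (kappa i0).
    by apply: (wl kappa) => //; rewrite -ki0 gez0_abs.
  have absN i : absz (- kappa i) = absz (kappa i) by rewrite abszN.
  apply: (wl (fun i => - kappa i)).
  - rewrite /relation -[RHS]oppr0 -[in RHS]rel -sumrN.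
    by apply: eq_bigr => i _; rewrite mulrNz.
  - by case: nz => i iD ki; exists i => //; rewrite oppr_eq0.
  - by move=> i iD; rewrite absN kK.
  - apply: leq_trans cnt; apply: subset_leq_card; apply/fintype.subsetP => i.
    by rewrite !inE absN.
  - by rewrite absN.
  - by rewrite -ki0 ltz0_abs.
have [m] := ubnP #|[pred i in D | kappa i < 0]|.
elim: m b kappa bpos rel nz kK cnt ki0 ki0' => // m IHm.
move=> b kappa bpos rel nz kK cnt ki0 ki0' neg.
have [j jD kj] : exists2 j, j \in D & kappa j < 0.
  by apply: relation_neg bpos rel i0D _; rewrite ki0'.
have ij : i0 != j by apply: contraTneq kj => <-; rewrite ki0'.
have ji : j != i0 by rewrite eq_sym.
have kjK := kK j jD.
have [e|p|p] := lpos_trichotomy total (b j - b i0).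
- by apply: (@reducible_eq D b i0 j) => //; apply/esym/eqP; rewrite -subr_eq0 e.
(* Here b_i0 < b_j: the coefficient at i0 becomes k_i0 + k_j, of absolute value below K + 1, so
   fewer indices reach the maximum. *)
- have i0K : (absz (kappa i0 + kappa j)%R < K.+1)%N by lia.
  apply: (@reducible_trans D b (subtract b i0 j)).
    by move=> k kD; apply: subtract_nat_comb.
  apply: (IHc _ (transfer kappa i0 j)).
  + exact: subtract_positive.
  + exact: subtract_relation.
  + by exists j => //; rewrite /transfer (negPf ji) lt_eqF.
  + by move=> k kD; rewrite /transfer; case: eqP => _; [exact: ltnW|exact: kK].
  + move: cnt; rewrite (cardD1 i0) inE i0D ki0 eqxx ltnS.
    move=> /(leq_trans _); apply; apply: subset_leq_card.
    apply/fintype.subsetP => k; rewrite !inE /transfer.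
    move=> /andP[->]; case: (eqVneq k i0) => [_ /eqP e|//].
    by rewrite e ltnn in i0K.
(* Here b_j < b_i0: the coefficient at j becomes k_j + k_i0, which lies between 0 and K, so the
   relation has one negative coefficient fewer and the one at i0 is unchanged. *)
- have jK : (absz (kappa j + kappa i0)%R < K.+1)%N by lia.
  apply: (@reducible_trans D b (subtract b j i0)).
    by move=> k kD; apply: subtract_nat_comb.
  apply: (IHm _ (transfer kappa j i0)).
  + by apply: subtract_positive; rewrite // -opprB.
  + exact: subtract_relation.
  + by exists i0 => //; rewrite /transfer (negPf ij) ki0'.
  + by move=> k kD; rewrite /transfer; case: eqP => _; [exact: ltnW|exact: kK].
  + apply: leq_trans cnt.
    apply: subset_leq_card; apply/fintype.subsetP => k; rewrite !inE /transfer.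
    move=> /andP[->]; case: (eqVneq k j) => [_ /eqP e|//].
    by rewrite e ltnn in jK.
  + by rewrite /transfer (negPf ij).
  + by rewrite /transfer (negPf ij).
  + move: neg; rewrite [in X in X -> _](cardD1 j) inE jD kj ltnS.
    move=> /(leq_trans _); apply; rewrite add1n ltnS.
    apply: subset_leq_card; apply/fintype.subsetP => k; rewrite !inE /transfer.
    case: eqVneq => [->|//]; rewrite jD /=; lia.
Qed.

(** Induction on the number of generators: a nontrivial integer relation allows the family to be
    replaced by a smaller one. *)
Lemma ultrasimplicial D b : positive_on D b -> exists D' b',
  [/\ positive_on D' b', independent D' b' &
      forall i, i \in D -> nat_comb D' b' (b i)].
Proof.
have [n] := ubnP #|D|; elim: n D b => // n IHn D b Dn bpos.
have [ind|dep] := pselect (independent D b).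
  by exists D, b; split=> // i; apply: nat_comb_gen.
have [D' [b' [D'D bpos' comb]]] : reducible D b.
  move: dep => /existsNP[kappa /not_implyP[rel]].
  move=> /existsNP[i /not_implyP[iD ki]].
  pose K := \max_(i in D) absz (kappa i).
  apply: (@relation_reducible D K #|D| b kappa) => //.
  - by exists i => //; apply/eqP.
  - by move=> j jD; apply: leq_bigmax_cond.
  - by apply: subset_leq_card; apply/fintype.subsetP => j /andP[].
have [D'' [b'' [? ? comb']]] := IHn D' b' (leq_trans D'D Dn) bpos'.
by exists D'', b''; split=> // i /comb; apply: nat_comb_trans.
Qed.

End Ultrasimplicial.

(** * Local embeddings from independent positive generators *)

Lemma local_emb_monotone (A B : plgroup) (s : seq A) (h : A -> B) :
  totally_ordered A -> h 0 = 0 -> h (plg_point A) = plg_point B ->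
  {in s, forall x, h (- x) = - h x} ->
  {in s &, forall x y, h (x + y) = h x + h y} ->
  {in s &, forall x y, lpos (y - x) -> lpos (h y - h x)} -> local_emb s h.
Proof.
move=> total h0 hp hN hD hpos.
have hle x y : x \in s -> y \in s -> lle x y -> lle (h x) (h y).
  move=> xs ys xy; have [e|p|/lposNF] := lpos_trichotomy total (y - x).
  - by rewrite (subr0_eq e) lle_refl.
  - by rewrite -lle_subr lposW// hpos.
  - by case; rewrite opprB -lle_subr sub0r opprB lle_subr.
have hM x y : x \in s -> y \in s -> lle x y ->
    lmeet (h x) (h y) = h (lmeet x y).
  by move=> xs ys xy; rewrite (eqP xy); apply/eqP/hle.
have hJ x y : x \in s -> y \in s -> lle x y ->
    ljoin (h x) (h y) = h (ljoin x y).
  move=> xs ys xy; move: (xy); rewrite lle_joinE => /eqP ->.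
  by apply/eqP; rewrite -lle_joinE hle.
split; first split=> //.
- move=> x y xs ys hxy; have [e|p|p] := lpos_trichotomy total (y - x).
  + by rewrite (subr0_eq e).
  + by have := hpos x y xs ys p; rewrite hxy subrr /lpos eqxx andbF.
  + rewrite opprB in p.
    by have := hpos y x ys xs p; rewrite hxy subrr /lpos eqxx andbF.
- by move=> x xs _; apply: hN.
- by move=> x y xs ys _; apply: hD.
- move=> x y xs ys _; have [xy|yx] := total x y; first by rewrite hM.
  by rewrite lmeetC [RHS]lmeetC hM.
- move=> x y xs ys _; have [xy|yx] := total x y; first by rewrite hJ.
  by rewrite ljoinC [RHS]ljoinC hJ.
Qed.

(** The map sends b_i to c_i and extends linearly to the span, which is consistent by independence.
    It is strictly increasing on [s] because positive differences are natural combinations of the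
    b_i. *)
Lemma ultrasimplicial_local_emb (A : plgroup) (s : seq A) :
  totally_ordered A -> positively_pointed A ->
  exists (T : finType) (D : pred T) (b : T -> A) (alpha : T -> nat),
  [/\ positive_on D b, independent D b,
      plg_point A = \sum_(i in D) b i *+ alpha i &
      forall (B : plgroup) (c : T -> B), positive_on D c ->
        \sum_(i in D) c i *+ alpha i = plg_point B ->
        exists h : A -> B, local_emb s h].
Proof.
move=> total pt0.
(* The negatives give coordinates to the negative elements of [s]; the differences give
   monotonicity. *)
pose l :=
  plg_point A :: s ++ [seq - x | x <- s] ++ [seq x - y | x <- s, y <- s].
pose Q := [seq z <- l | lpos z].
have [|D [b [bpos ind comb]]] :=
    @ultrasimplicial A 'I_(size Q) total predT (fun i => Q`_i).
  by move=> i _; have /(mem_nth 0) := ltn_ord i; rewrite mem_filter => /andP[].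
have natQ z : lpos z -> z \in l -> nat_comb D b z.
  move=> pz zl; have zQ : z \in Q by rewrite mem_filter pz.
  have zlt : (index z Q < size Q)%N by rewrite index_mem.
  by have := comb (Ordinal zlt) isT; rewrite /= nth_index.
have [alpha ptE] : nat_comb D b (plg_point A).
  have [->|/eqP np] := eqVneq (plg_point A) 0; first exact: nat_comb0.
  by apply: natQ; rewrite ?mem_head// /lpos pt0; apply/eqP.
exists _, D, b, alpha; split=> // B c cpos cpt.
pose rep (x : A) (k : _ -> int) := x = \sum_(i in D) b i *~ k i.
(* Outside the span of the b_i the coordinates are set to 0; such elements are never in [s]. *)
have /boolp.choice[coef coefP] (x : A) : exists f, forall k, rep x k -> rep x f.
  have [[k xk]|nx] := pselect (exists k, rep x k); first by exists k.
  by exists (fun=> 0) => k xk; case: nx; exists k.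
pose h x : B := \sum_(i in D) c i *~ coef x i.
have hE x k : rep x k -> h x = \sum_(i in D) c i *~ k i.
  move=> xk; apply: eq_bigr => i iD; congr (_ *~ _).
  apply/eqP; rewrite -subr_eq0; apply/eqP.
  apply: (ind (fun i => coef x i - k i)) => //.
  rewrite /relation; under eq_bigr do rewrite mulrzBr.
  by rewrite sumrB -(coefP x k xk) -xk subrr.
have repD x y k k' : rep x k -> rep y k' -> rep (x + y) (fun i => k i + k' i).
  move=> -> ->; rewrite /rep -big_split.
  by apply: eq_bigr => i _; rewrite mulrzDr.
have repN x k : rep x k -> rep (- x) (fun i => - k i).
  by move=> ->; rewrite /rep -sumrN; apply: eq_bigr => i _; rewrite mulrNz.
have natrep x (k : _ -> nat) :
  x = \sum_(i in D) b i *+ k i -> rep x (fun i => (k i)%:Z) by [].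
have reps x : x \in s -> exists k, rep x k.
  move=> xs; have [->|p|p] := lpos_trichotomy total x.
  - by exists (fun=> 0); rewrite /rep big1.
  - have [|k /natrep xk] := natQ x p; last by eexists; exact: xk.
    by rewrite inE mem_cat xs orbT.
  - have [|k /natrep/repN xk] := natQ (- x) p; last first.
      by eexists; rewrite -[x]opprK; exact: xk.
    by rewrite inE !mem_cat map_f ?orbT.
have hD x y k k' : rep x k -> rep y k' -> h (x + y) = h x + h y.
  move=> xk yk; rewrite (hE _ _ (repD _ _ _ _ xk yk)) (hE _ _ xk) (hE _ _ yk).
  by rewrite -big_split; apply: eq_bigr => i _; rewrite mulrzDr.
exists h; apply: local_emb_monotone => //.
- by rewrite (hE _ (fun=> 0)) /rep big1.
- by rewrite (hE _ _ (natrep _ _ ptE)) -cpt.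
- move=> x /reps[k xk]; rewrite (hE _ _ (repN _ _ xk)) (hE _ _ xk) -sumrN.
  by apply: eq_bigr => i _; rewrite mulrNz.
- by move=> x y /reps[k xk] /reps[k' yk]; apply: hD xk yk.
- move=> x y xs ys p; have [k xk] := reps x xs.
  have [|k' /natrep zk] := natQ (y - x) p.
    by rewrite inE !mem_cat (allpairs_f (fun x y => x - y)) ?orbT.
  rewrite -[in h y](subrK x y) (hD _ _ _ _ zk xk) addrK (hE _ _ zk).
  have [i iD ki] : exists2 i, i \in D & (0 < k' i)%N.
    apply: contrapT => nok; move: p.
    rewrite zk big1 /lpos ?eqxx ?andbF// => i iD.
    by case E : (k' i) => //; case: nok; exists i; rewrite ?E.
  apply: (lpos_sum (i := i)) => // [j jD|]; first exact/lnnegMn/lposW/cpos.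
  exact/lposMn/ki/cpos.
Qed.

(** * Bezout coefficients *)

Lemma bezout_seq (T : eqType) (r : seq T) (alpha : T -> nat) : uniq r ->
  exists (g : nat) (u : T -> int), {in r, forall i, (g %| alpha i)%N} /\
    \sum_(i <- r) (alpha i)%:Z * u i = g.
Proof.
elim: r => [|x r IHr] /=; first by exists 0%N, (fun=> 0); rewrite big_nil.
move=> /andP[xr /IHr[g [u [gr ug]]]].
have [v [w vw]] := Bezoutz (alpha x) g.
exists (gcdn (alpha x) g), (fun i => if i == x then v else u i * w); split.
  move=> i; rewrite inE => /predU1P[->|/gr]; first exact: dvdn_gcdl.
  by apply: dvdn_trans; apply: dvdn_gcdr.
rewrite big_cons eqxx -[RHS]/(gcdz (alpha x) g) -vw -ug mulrC; congr (_ + _).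
rewrite mulr_sumr; apply: eq_big_seq => i ir.
by case: eqP => [ix|_]; [rewrite ix (negPf xr) in ir|ring].
Qed.

Lemma bezout (T : finType) (D : pred T) (alpha : T -> nat) :
  (exists2 i, i \in D & (0 < alpha i)%N) ->
  exists (g : nat) (beta : T -> nat) (u : T -> int),
  [/\ (0 < g)%N, forall i, i \in D -> alpha i = (beta i * g)%N &
      \sum_(i in D) (beta i)%:Z * u i = 1].
Proof.
move=> [i0 i0D a0].
have [g [u [gD ug]]] := bezout_seq alpha (enum_uniq D).
have gP i : i \in D -> (g %| alpha i)%N.
  by move=> iD; apply: gD; rewrite mem_enum.
have g0 : (0 < g)%N by apply: dvdn_gt0 (gP i0 i0D).
exists g, (fun i => alpha i %/ g)%N, u; split=> // [i iD|].
  by rewrite divnK// gP.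
have gz : g%:Z != 0 by rewrite -lt0n.
apply: (mulfI gz); rewrite mulr1 -[RHS]ug mulr_sumr big_enum/=.
apply: eq_bigr => i iD; rewrite mulrA; congr (_ * _).
by rewrite -PoszM mulnC divnK// gP.
Qed.

Lemma sum_mulrn_factor (V : zmodType) (T : finType) (D : pred T) (c : T -> V)
    (alpha beta : T -> nat) (g : nat) :
  (forall i, i \in D -> alpha i = (beta i * g)%N) ->
  \sum_(i in D) c i *+ alpha i = (\sum_(i in D) c i *+ beta i) *+ g.
Proof.
by move=> E; rewrite -sumrMnl; apply: eq_bigr => i /E ->; rewrite mulrnA.
Qed.

Lemma pivot_exists (T : finType) (D : pred T) (beta : T -> nat) (u : T -> int) :
  \sum_(i in D) (beta i)%:Z * u i = 1 -> exists2 p, p \in D & (0 < beta p)%N.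
Proof.
move=> sum1; apply: contrapT => nop; have /eqP := sum1.
rewrite big1 // => i iD; case E : (beta i) => [|n]; first by rewrite mul0r.
by case: nop; exists i; rewrite ?E.
Qed.

(** * Positive solutions by density *)

Section DenseAt.
Variable G : lGroupType.
Hypothesis total : forall x y : G, lle x y \/ lle y x.

(** The coset of u e modulo multiples of beta contains positive elements that are arbitrarily small
    compared with e. *)
Definition dense_at (e : G) := forall (N beta : nat) (u : int), (0 < beta)%N ->
  exists t : G,
    lpos (e *~ u + t *+ beta) /\ lpos (e - (e *~ u + t *+ beta) *+ N).

(** The elements u_i e solve the equation. Fix p with beta_p > 0; for i other than p, adding beta_p
    t_i makes the i-th term positive and so small that the remainder left for p stays positive,
    while subtracting sum beta_i t_i at p preserves the equation. *)
Lemma dense_at_solve (T : finType) (D : pred T) (beta : T -> nat) (u : T -> int)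
    (e : G) : lpos e -> dense_at e -> \sum_(i in D) (beta i)%:Z * u i = 1 ->
  exists2 c : T -> G, positive_on D c & \sum_(i in D) c i *+ beta i = e.
Proof.
move=> epos dens sum1; have [p pD bp] := pivot_exists sum1.
pose S := (\sum_(i in D | i != p) beta i)%N.
have /boolp.choice[t tP] (i : T) := dens S.+1 (beta p) (u i) bp.
pose d i := e *~ u i + t i *+ beta p.
pose E := \sum_(i in D | i != p) e *~ ((beta i)%:Z * u i).
pose W := \sum_(i in D | i != p) t i *+ beta i.
pose Z := \sum_(i in D | i != p) d i *+ beta i.
have ZE : Z = E + W *+ beta p.
  rewrite /E /W -sumrMnl -big_split; apply: eq_bigr => i _ /=.
  by rewrite /d; zmodule.
have EE : E = e - e *~ ((beta p)%:Z * u p).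
  apply: (addIr (e *~ ((beta p)%:Z * u p))); rewrite subrK addrC.
  by rewrite -[RHS]mulr1z -sum1 (bigD1 p)//= mulrzDr mulrz_sumr.
pose c i := if i == p then e *~ u p - W else d i.
have cp : c p *+ beta p = e - Z.
  by rewrite /c eqxx ZE EE; zmodule.
exists c; last first.
  rewrite (bigD1 p)//= cp [X in _ + X](_ : _ = Z) ?subrK//.
  by apply: eq_bigr => i /andP[_ /negPf ip]; rewrite /c ip.
move=> i iD; have [->|ip] := eqVneq i p; last first.
  by rewrite /c (negPf ip); have [] := tP i.
apply: (lposMn_inv total (n := beta p)); rewrite cp.
apply: (lposMn_inv total (n := S.+1)).
(* With S the sum of the other beta_i, each d_i below e/(S + 1) makes the right side positive. *)
have -> : (e - Z) *+ S.+1 =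
    e + \sum_(i in D | i != p) (e - d i *+ S.+1) *+ beta i.
  transitivity (e + (e *+ S - Z *+ S.+1)); first by zmodule.
  rewrite /S /Z -sumrMnl -sumrMnr -sumrB; congr (_ + _); apply: eq_bigr => k _.
  zmodule.
apply: lposDl => //.
elim/big_ind: _ => [||k _]; [exact: lle_refl|exact: lnnegD|].
by apply/lnnegMn/lposW; have [] := tP k.
Qed.

Lemma int_crossing (P : int -> Prop) (lo : int) (k : nat) :
  ~ P lo -> P (lo + k%:Z) -> exists n, P n /\ ~ P (n - 1).
Proof.
move=> nlo; elim: k => [|k IHk] Pk; first by rewrite addr0 in Pk.
have [/IHk//|nk] := pselect (P (lo + k%:Z)).
exists (lo + k.+1%:Z); split=> //.
by have -> : lo + k.+1%:Z - 1 = lo + k%:Z by lia.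
Qed.

(* The archimedean component of a, modulo infinitesimals, is dense in the     *)
(* reals.                                                                     *)
Definition dense_point (a : G) := forall M : nat, exists (x : G) (M' : nat),
  [/\ lpos x, lpos (a - x *+ M) & lle a (x *+ M')].

(** Take x > 0 with N beta g x < a, that is N beta x < e, and the multiple t = n x at which u e +
    beta t first becomes positive; it is then at most beta x. Such an n exists since e is bounded by
    a multiple of x. *)
Lemma dense_point_at (a e : G) (g : nat) : lpos e -> (0 < g)%N ->
  a = e *+ g -> dense_point a -> dense_at e.
Proof.
move=> epos g0 aE dens N beta u b0.
have [x [M' [xpos xM aM']]] := dens (N * beta * g)%N.
pose L := (M' * absz u)%N.
have xe : lle 0 (x *+ M' - e).
  have -> : x *+ M' - e = (x *+ M' - a) + e *+ g.-1.
    by rewrite aE -{1}(prednK g0); zmodule.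
  by apply: lnnegD; [rewrite lle_subr|apply/lnnegMn/lposW].
have bound (v : int) : absz v = absz u -> lle 0 (x *+ L + e *~ v).
  move=> vu; have [n nE] : exists n : nat, (absz v)%:Z + v = n%:Z.
    by exists (absz ((absz v)%:Z + v)); lia.
  have -> : x *+ L + e *~ v = (x *+ M' - e) *+ absz u + e *+ n.
    by rewrite /L -vu !(pmulrn e) -nE; zmodule.
  by apply: lnnegD; apply: lnnegMn => //; apply: lposW.
pose P n := lpos (e *~ u + x *~ n *+ beta).
have [||n [Pn nPn]] := @int_crossing P (- L%:Z) (L + L.+1).
- rewrite /P; apply/negP/lposPn => //; rewrite -lle_subr.
  have -> : 0 - (e *~ u + x *~ - L%:Z *+ beta) =
      (x *+ L + e *~ (- u)) + x *+ (L * beta.-1).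
    by rewrite -{1}(prednK b0); zmodule.
  by apply: lnnegD; [apply: bound; rewrite abszN|apply/lnnegMn/lposW].
- have -> : - L%:Z + (L + L.+1)%N%:Z = L.+1%:Z by lia.
  rewrite /P; have -> : e *~ u + x *~ L.+1%:Z *+ beta =
      (x *+ L + e *~ u) + x *+ (L * beta.-1 + beta).
    by rewrite -{1}(prednK b0); zmodule.
  by apply: lposDr; [apply: bound|apply: lposMn; rewrite // addn_gt0 b0 orbT].
exists (x *~ n); split=> //.
move: nPn => /negP/lposPn; rewrite -lle_subr => /(_ total) xv.
have exN : lpos (e - x *+ (N * beta)).
  apply: (lposMn_inv total (n := g)).
  suff -> : (e - x *+ (N * beta)) *+ g = a - x *+ (N * beta * g) by [].
  by rewrite aE; zmodule.
have -> : e - (e *~ u + x *~ n *+ beta) *+ N = (e - x *+ (N * beta)) +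
   (0 - (e *~ u + x *~ (n - 1) *+ beta)) *+ N by zmodule.
by apply: lposDl => //; apply: lnnegMn.
Qed.

End DenseAt.

(** * Infinitesimals and the discrete case *)

Section Infinitesimal.
Variables (G : lGroupType) (a : G).
Hypothesis total : forall x y : G, lle x y \/ lle y x.
Hypothesis apos : lpos a.
Implicit Types x y : G.

Definition infinitesimal y :=
  forall N : nat, lpos (a - y *+ N) /\ lpos (a + y *+ N).

Lemma infinitesimal0 : infinitesimal 0.
Proof. by move=> N; rewrite mul0rn subr0 addr0. Qed.

Lemma infinitesimalN y : infinitesimal y -> infinitesimal (- y).
Proof. by move=> yi N; have [p q] := yi N; rewrite mulNrn opprK. Qed.

Lemma infinitesimalD x y :
  infinitesimal x -> infinitesimal y -> infinitesimal (x + y).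
Proof.
move=> xi yi N; have [p q] := xi (2 * N)%N; have [p' q'] := yi (2 * N)%N.
split; apply: (lposMn_inv total (n := 2)).
  by have -> : (a - (x + y) *+ N) *+ 2 = (a - x *+ (2 * N)) + (a - y *+ (2 * N))
    by [zmodule]; apply: lposD.
by have -> : (a + (x + y) *+ N) *+ 2 = (a + x *+ (2 * N)) + (a + y *+ (2 * N))
  by [zmodule]; apply: lposD.
Qed.

Lemma infinitesimalMn y n : infinitesimal y -> infinitesimal (y *+ n).
Proof. by move=> yi N; rewrite -mulrnA; apply: yi. Qed.

Lemma infinitesimalMz y n : infinitesimal y -> infinitesimal (y *~ n).
Proof.
by case: n => n yi; rewrite ?NegzE ?mulrNz; [|apply: infinitesimalN];
  apply: infinitesimalMn.
Qed.

Lemma infinitesimal_sum (T : finType) (D : pred T) (F : T -> G) :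
  (forall i, i \in D -> infinitesimal (F i)) ->
  infinitesimal (\sum_(i in D) F i).
Proof.
move=> Fi; elim/big_ind: _ => //; first exact: infinitesimal0.
exact: infinitesimalD.
Qed.

Lemma infinitesimal_pointN : ~ infinitesimal a.
Proof. by move=> /(_ 1%N)[]; rewrite subrr /lpos eqxx andbF. Qed.

Lemma infinitesimalPn y : lpos y -> ~ infinitesimal y ->
  exists N, lle a (y *+ N).
Proof.
move=> ypos; apply: contra_notP => noN N; split; last first.
  by apply: lposDl => //; apply/lnnegMn/lposW.
have [//|/(lposPn total)] := boolP (lpos (a - y *+ N)).
by rewrite -lle_subr sub0r opprB lle_subr => h; case: noN; exists N.
Qed.

(** The negation of [dense_point a]: one bound M0 serves all positive elements that are not
    infinitesimal. *)
Variable M0 : nat.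
Hypothesis discrete : forall x (M : nat),
  lpos x -> lle a (x *+ M) -> lle a (x *+ M0).

(** Choose u positive, not infinitesimal, with m u <= a for the largest possible m, which is at most
    M0. If 2 r <= u with r not infinitesimal, then 2 m r <= a contradicts maximality. *)
Lemma unit_exists : exists u, [/\ lpos u, ~ infinitesimal u &
  forall r, lpos r -> lle (r *+ 2) u -> infinitesimal r].
Proof.
pose P m := `[< exists u, [/\ lpos u, ~ infinitesimal u & lle (u *+ m) a] >].
have exP : exists m, P m.
  by exists 1%N; apply/asboolP; exists a; rewrite lle_refl;
    split=> //; apply: infinitesimal_pointN.
have bP m : P m -> (m <= M0)%N.
  move=> /asboolP[u [upos ninf um]]; rewrite leqNgt; apply/negP => mM.
  have [N uN] := infinitesimalPn upos ninf.
  have := lle_trans um (discrete upos uN).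
  rewrite -{1}(subnKC (ltnW mM)) mulrnDr -{2}[u *+ M0]addr0 lle_D2l.
  by apply: lposNF; apply: lposMn; rewrite // subn_gt0.
have [m /asboolP[u [upos ninf um]] maxm] := ex_maxnP exP bP.
have m0 : (0 < m)%N.
  by apply: maxm; apply/asboolP; exists a; rewrite lle_refl;
    split=> //; apply: infinitesimal_pointN.
exists u; split=> // r rpos r2u; apply: contrapT => nr.
have : P (2 * m)%N.
  apply/asboolP; exists r; split=> //; apply: lle_trans um.
  rewrite -lle_subr.
  have -> : u *+ m - r *+ (2 * m) = (u - r *+ 2) *+ m by zmodule.
  by apply: lnnegMn; rewrite lle_subr.
by move=> /maxm; lia.
Qed.

Variable u : G.
Hypotheses (upos : lpos u) (uninf : ~ infinitesimal u).
Hypothesis umin : forall r, lpos r -> lle (r *+ 2) u -> infinitesimal r.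

Lemma lle_unit : lle a (u *+ M0).
Proof. by have [N] := infinitesimalPn upos uninf; apply: discrete. Qed.

(** If k u <= y < (k + 1) u, the distances from y to both ends add up to u. The smaller one is at
    most half of u, hence infinitesimal. *)
Lemma nearest_multiple y : lpos y -> lle y a ->
  exists q : nat, infinitesimal (y - u *+ q).
Proof.
move=> ypos ya; pose P (n : int) := lpos (u *~ n - y).
have [||n [Pn nPn]] := @int_crossing P 0 M0.+1.
- rewrite /P mulr0z sub0r => /lposNF; apply; rewrite -lle_subr.
  by rewrite sub0r opprK lposW.
- rewrite /P add0r -pmulrn mulrS -addrA lposDl// lle_subr.
  exact/(lle_trans ya)/lle_unit.
have n0 : 0 < n.
  rewrite ltNge; apply/negP => n0; move: Pn => /lposNF; apply.
  rewrite -lle_subr; have -> : 0 - (u *~ n - y) = y + u *~ (- n) by zmodule.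
  apply: lnnegD; first exact: lposW.
  have -> : u *~ (- n) = u *+ absz n by rewrite pmulrn; congr (_ *~ _); lia.
  exact/lnnegMn/lposW.
have nE : n = (absz n).-1.+1%:Z by lia.
set k := (absz n).-1 in nE.
have r0 : lle 0 (y - u *+ k).
  move: nPn; rewrite /P => /negP/(lposPn total); rewrite -lle_subr.
  congr (lle _ _); rewrite nE; zmodule.
move: Pn; rewrite /P nE => r'pos.
have [e|rpos|/lposNF] := lpos_trichotomy total (y - u *+ k); last first.
- by case; rewrite -lle_subr sub0r opprK.
- have [r2|r2] := total ((y - u *+ k) *+ 2) u; first by exists k; apply: umin.
  exists k.+1; have -> : y - u *+ k.+1 = - (u *~ k.+1 - y) by zmodule.
  apply/infinitesimalN/umin => //; rewrite -lle_subr.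
  have -> : u - (u *~ k.+1 - y) *+ 2 = (y - u *+ k) *+ 2 - u by zmodule.
  by rewrite lle_subr.
- by exists k; rewrite e; apply: infinitesimal0.
Qed.

Lemma lpos_unitD z : infinitesimal z -> lpos (u + z).
Proof.
move=> zi; apply: (lposMn_inv total (n := M0)).
have -> : (u + z) *+ M0 = (u *+ M0 - a) + (a + z *+ M0) by zmodule.
by apply: lposDr; [rewrite lle_subr lle_unit|case: (zi M0)].
Qed.

(** Makes the infinitesimal error strictly positive. If e - j u is not positive, u is shifted down
    to x = u + (e - j u) - w, which leaves e - j x >= w. *)
Lemma unit_adjust (e w : G) (j : nat) : (0 < j)%N ->
  infinitesimal (e - u *+ j) -> lpos w -> infinitesimal w ->
  exists x eps, [/\ infinitesimal (x - u), lpos eps, infinitesimal eps &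
    e = x *+ j + eps].
Proof.
move=> j0 ei wpos wi.
have [p|/(lposPn total) np] := boolP (lpos (e - u *+ j)).
  exists u, (e - u *+ j); rewrite subrr; split=> //; last by zmodule.
  exact: infinitesimal0.
pose x := u + (e - u *+ j) - w.
have xi : infinitesimal (x - u).
  have -> : x - u = (e - u *+ j) + - w by rewrite /x; zmodule.
  exact/infinitesimalD/infinitesimalN.
exists x, (e - x *+ j); split=> //; last by zmodule.
  have -> : e - x *+ j = w + (- (e - u *+ j) + w) *+ j.-1.
    by rewrite /x -{1 2 3}(prednK j0); zmodule.
  apply: lposDl => //; apply/lnnegMn/lnnegD; last exact: lposW.
  by rewrite -sub0r lle_subr.
have -> : e - x *+ j = (e - u *+ j) + - ((x - u) *+ j) by zmodule.
exact/infinitesimalD/infinitesimalN/infinitesimalMn.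
Qed.

(** Hence (m, r) |-> m x + r eps is an order embedding of the lexicographic product: x plus any
    infinitesimal is positive, so the first coordinate dominates. *)
Lemma lex_positive (x eps : G) (m r : int) : infinitesimal (x - u) ->
  lpos eps -> infinitesimal eps -> (0 < m) || (m == 0) && (0 < r) ->
  lpos (x *~ m + eps *~ r).
Proof.
move=> xi epos ei.
have xpos z : infinitesimal z -> lpos (x + z).
  move=> zi; have -> : x + z = u + ((x - u) + z) by zmodule.
  exact/lpos_unitD/infinitesimalD.
case/orP => [m0|/andP[/eqP-> r0]].
  have -> : x *~ m + eps *~ r = (x + eps *~ r) + x *+ (absz m).-1.
    have -> : m = (absz m).-1.+1%:Z by lia.
    by rewrite absz_nat /=; zmodule.
  apply: lposDl; first exact/xpos/infinitesimalMz.
  by apply/lnnegMn/lposW; rewrite -[x]addr0; apply/xpos/infinitesimal0.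
rewrite mulr0z add0r; case: r r0 => // r r0; exact: lposMn.
Qed.

End Infinitesimal.

(** * The lexicographic product of two copies of the integers *)

Lemma lpos_int (n : int) : lpos n = (0 < n).
Proof.
rewrite /lpos lt_neqAle eq_sym andbC; congr (_ && _); rewrite /lle.
exact: eq_minl.
Qed.

Lemma lpos_lex_int (p : lex int int) :
  lpos p = (0 < p.1) || (p.1 == 0) && (0 < p.2).
Proof.
rewrite /lpos lle_lexE /lex_le -!lpos_int /lpos; case: p => m r /=.
have -> : ((m, r) == 0 :> lex int int) = (m == 0) && (r == 0) by [].
by rewrite [0 == m]eq_sym; case: (m == 0); case: (lle 0 m); case: (lle 0 r).
Qed.

Lemma lex_int_mulrn (m r : int) (k : nat) :
  ((m, r) : lex int int) *+ k = (m *+ k, r *+ k).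
Proof. by elim: k => // k IHk; rewrite !mulrS IHk. Qed.

Lemma lex_int_sum (T : finType) (D : pred T) (m r : T -> int)
    (alpha : T -> nat) :
  \sum_(i in D) ((m i, r i) : lex int int) *+ alpha i =
  (\sum_(i in D) m i *+ alpha i, \sum_(i in D) r i *+ alpha i).
Proof. by elim/big_rec3: _ => // i x y z iD ->; rewrite lex_int_mulrn. Qed.

Lemma pointed_lex_int_total j d : totally_ordered (pointed_lex_int j d).
Proof.
move=> p q; have [->|npq] := eqVneq p q; first by left; rewrite lle_refl.
suff: lpos (q - p) || lpos (p - q).
  by move=> /orP[]/lposW; rewrite lle_subr; [left|right].
rewrite !lpos_lex_int.
have : (p.1 != q.1) || (p.2 != q.2) by rewrite -negb_and.
rewrite -[(q - p).1]/(q.1 - p.1) -[(q - p).2]/(q.2 - p.2).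
rewrite -[(p - q).1]/(p.1 - q.1) -[(p - q).2]/(p.2 - q.2).
lia.
Qed.

(** Start from r = u, make r_i positive for i other than p by adding multiples of beta_p, and
    compensate at p. The resulting sign of r_p is harmless as m_p > 0. *)
Lemma lex_solve (T : finType) (D : pred T) (beta m : T -> nat) (u : T -> int)
    (p : T) : \sum_(i in D) (beta i)%:Z * u i = 1 ->
  p \in D -> (0 < beta p)%N -> (0 < m p)%N ->
  exists2 r : T -> int, \sum_(i in D) r i *+ beta i = 1 &
    positive_on D (fun i => ((m i)%:Z, r i) : lex int int).
Proof.
move=> sum1 pD bp mp.
have assoc (v : int) (k l n : nat) :
    (v + (k * l)%:Z) *+ n = n%:Z * v + (n * l)%:Z *+ k.
  by rewrite !PoszM; ring.
pose t i := (absz (u i)).+1.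
pose r i := if i == p then u p - \sum_(k in D | k != p) (beta k * t k)%:Z
            else u i + (beta p * t i)%:Z.
exists r.
  rewrite -sum1 (bigD1 p)//= [RHS](bigD1 p)//= /r eqxx.
  rewrite [X in _ + X](_ : _ = \sum_(k in D | k != p) (beta k)%:Z * u k +
     (\sum_(k in D | k != p) (beta k * t k)%:Z) *+ beta p).
    by rewrite mulrnBl addrACA addNr addr0 pmulrn mulrzz mulrC.
  rewrite -sumrMnl -big_split; apply: eq_bigr => k /andP[_ /negPf ->] /=.
  exact: assoc.
move=> i iD; rewrite lpos_lex_int /= /r; have [->|ip] := eqVneq i p.
  by rewrite ltz_nat mp.
suff -> : 0 < u i + (beta p * t i)%:Z.
  by rewrite andbT -[_ == 0]/(m i == 0)%N -[0 < _]/(0 < m i)%N; case: (m i).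
have : (t i <= beta p * t i)%N by rewrite leq_pmull.
rewrite /t; lia.
Qed.

(** * Embedding the integers in members of M *)

Lemma morphism_local_emb (A B : plgroup) (s : seq A) (h : A -> B) :
  totally_ordered A -> {morph h : x y / x + y} ->
  h (plg_point A) = plg_point B -> (forall x, lpos x -> lpos (h x)) ->
  local_emb s h.
Proof.
move=> total hD hp hpos.
have h0 : h 0 = 0 by apply: (addrI (h 0)); rewrite -hD !addr0.
have hN x : h (- x) = - h x by apply: (addrI (h x)); rewrite -hD !subrr h0.
apply: local_emb_monotone => // x y _ _ /hpos.
by rewrite hD hN.
Qed.

Lemma universal_class_embedding (M : plclass) (A B : plgroup) :
  universal_class M -> M A ->
  (forall s : seq B, exists h : B -> A, local_emb s h) -> M B.
Proof.
move=> univ MA emb; apply: (universal_class_locally_in univ) => s.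
by have [h hE] := emb s; exists A, h.
Qed.

Lemma pointed_int_total n : totally_ordered (pointed_int n).
Proof. by move=> x y; apply/orP; apply: lle_total. Qed.

Lemma pointed_int_emb (A : plgroup) (n : nat) (x : A)
    (s : seq (pointed_int n)) :
  lpos x -> plg_point A = x *+ n ->
  exists h : pointed_int n -> A, local_emb s h.
Proof.
move=> xpos ptE; exists (fun k : int => x *~ k).
apply: morphism_local_emb; first exact: pointed_int_total.
- by move=> k l; rewrite mulrzDr.
- by rewrite ptE.
- by move=> k; rewrite lpos_int; case: k => // k k0; apply: lposMn.
Qed.

Section PointedInt.
Variables (M : plclass).
Hypotheses (univ : universal_class M)
  (M_total : forall A, M A -> totally_ordered A).

(** A nontrivial member pointed at 0 has a positive element, whose multiples form a copy of Z_0;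
    [trivial_covered] supplies such a member when A is trivial. *)
Lemma universal_int0 : trivial_covered M -> forall A : plgroup, M A ->
  plg_point A = 0 -> M (pointed_int 0).
Proof.
move=> cov.
suff nontriv A : M A -> ~ trivial_alg A -> plg_point A = 0 -> M (pointed_int 0).
  move=> A MA ptE; have [triv|] := pselect (trivial_alg A); last first.
    by move=> nt; apply: (nontriv A).
  have [|B [MB nt pB]] := cov; first by exists A.
  exact: nontriv MB nt pB.
move=> MA /existsNP[x /eqP x0] ptE.
have [y ypos] : exists y : A, lpos y.
  have [xE|p|p] := lpos_trichotomy (M_total MA) x; last 2 first.
  - by exists x.
  - by exists (- x).
  - by rewrite xE eqxx in x0.
apply: (universal_class_embedding univ MA) => s.
by apply: (pointed_int_emb s ypos); rewrite ptE.
Qed.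

End PointedInt.

(** * The dense group S and its local embeddings *)

Section PointedRealsTheory.
Variables (R : realType) (S : lsubgroup R).
Hypotheses (S_dense : dense (S : set R))
  (SQ : (S : set R) `&` range (@ratr R) = range (fun z : int => z%:~R)).

Lemma lle_lsub (x y : lsub S) : lle x y = (val x <= val y).
Proof. by rewrite -eq_minl /lle -(inj_eq val_inj). Qed.

Lemma pointed_reals_total k : totally_ordered (pointed_reals SQ k).
Proof. by move=> x y; rewrite !lle_lsub; apply/orP/le_total. Qed.

Lemma lpos_lsub (x : lsub S) : lpos x = (0 < val x).
Proof.
by rewrite /lpos lle_lsub lt_neqAle eq_sym andbC -(inj_eq val_inj) raddf0.
Qed.

Let one : lsub S := plg_point (pointed_reals SQ 1).

Lemma lpos_one : lpos one.
Proof. by rewrite lpos_lsub ltr01. Qed.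

Lemma pointed_reals_point k : plg_point (pointed_reals SQ k) = one *+ k.
Proof. by apply: val_inj; rewrite raddfMn. Qed.

Lemma dense_at_one : dense_at one.
Proof.
move=> N beta u b0.
have b0R : 0 < beta%:R :> R by rewrite ltr0n.
have N0R : 0 < N.+1%:R :> R by rewrite ltr0n.
pose l : R := - u%:~R / beta%:R.
(* For y strictly between l and r, u + beta y lies strictly between 0 and 1/(N + 1). *)
pose r : R := l + (N.+1%:R * beta%:R)^-1.
have lr : l < r by rewrite ltrDl invr_gt0 mulr_gt0.
have [||y [/=]] := S_dense (O := `]l, r[%classic).
- by exists ((l + r) / 2); rewrite /= in_itv /= !(midf_lt lr).
- exact: interval_open.
rewrite in_itv /= => /andP[ly yr] Sy.
pose t : lsub S := exist _ y (mem_set Sy).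
exists t.
have vE : val (one *~ u + t *+ beta) = u%:~R + y * beta%:R.
  by rewrite raddfD raddfMz raddfMn /= mulr_natr.
set v : lsub S := _ + _ in vE *.
have v0 : 0 < u%:~R + y * beta%:R.
  by move: ly; rewrite /l ltr_pdivrMr// -subr_gt0 opprK addrC.
split; rewrite lpos_lsub; first by rewrite vE.
have -> : val (one - v *+ N) = 1 - val v *+ N by rewrite raddfB raddfMn.
rewrite vE subr_gt0 -[X in X < _]mulr_natr.
have vN : (u%:~R + y * beta%:R) * N.+1%:R < 1.
  rewrite -ltr_pdivlMr// mul1r -ltrBrDl.
  move: yr; rewrite -(ltr_pM2r b0R) => /lt_le_trans; apply.
  by rewrite /r /l mulrDl invfM !mulfVK ?gt_eqF// addrC.
by apply: le_lt_trans vN; rewrite ler_wpM2l ?(ltW v0)// ler_nat leqnSn.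
Qed.

End PointedRealsTheory.

Section PointedRealsEmbedding.
Variables (R : realType) (S : lsubgroup R).
Hypotheses (S_dense : dense (S : set R))
  (SQ : (S : set R) `&` range (@ratr R) = range (fun z : int => z%:~R)).

(** A finite part of S_k yields coprime beta_i with k = g z, where z = sum beta_i b_i. As z is
    rational and in S, it is an integer n, so the equation to solve in A has right side n e, where
    [dense_point] applies. *)
Lemma pointed_reals_emb (A : plgroup) (e : A) (k : nat)
    (s : seq (pointed_reals SQ k)) : totally_ordered A -> (0 < k)%N ->
  lpos e -> plg_point A = e *+ k -> dense_point (plg_point A) ->
  exists h : pointed_reals SQ k -> A, local_emb s h.
Proof.
move=> total k0 epos ptE dens.
have pt0 : lpos (plg_point (pointed_reals SQ k)).
  by rewrite pointed_reals_point lposMn// lpos_one.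
have [T [D [b [alpha [bpos ind bpt emb]]]]] :=
  ultrasimplicial_local_emb s (@pointed_reals_total R S SQ k) (lposW pt0).
have [|g [beta [u [g0 gE sum1]]]] := @bezout T D alpha.
  apply: contrapT => noa; move: pt0.
  rewrite bpt big1 ?/lpos ?eqxx ?andbF// => i iD.
  by case E : (alpha i) => //; case: noa; exists i; rewrite ?E.
pose z := \sum_(i in D) b i *+ beta i.
have zg : (val z) *+ g = k%:R.
  have <- : val (plg_point (pointed_reals SQ k)) = k%:R by [].
  by rewrite bpt (sum_mulrn_factor _ gE) raddfMn.
have [n nE] : exists n : nat, k = (n * g)%N.
  have : ((S : set R) `&` range (@ratr R)) (val z).
    split; first exact/set_mem/(valP z).
    exists (k%:R / g%:R); first by [].
    rewrite fmorph_div /= !rmorph_nat -zg -[val z *+ g]mulr_natr mulfK//.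
    by rewrite pnatr_eq0 -lt0n.
  rewrite SQ => -[n _ nz]; exists (absz n).
  have : (n * g%:Z)%:~R = k%:Z%:~R :> R.
    by rewrite intrM nz -!pmulrn mulr_natr.
  move=> /intr_inj; lia.
have n0 : (0 < n)%N by move: k0; rewrite nE; case: (n).
have [c cpos cE] : exists2 c : T -> A, positive_on D c &
    \sum_(i in D) c i *+ beta i = e *+ n.
  apply: (@dense_at_solve A total T D beta u) => //; first exact: lposMn.
  apply: (@dense_point_at A total (plg_point A) (e *+ n) g) => //.
    exact: lposMn.
  by rewrite ptE nE mulrnA.
apply: (emb A c cpos).
by rewrite (sum_mulrn_factor _ gE) cE ptE nE mulrnA.
Qed.

(** * Members of a universal class embed locally in its generators *)

Section Generators.
Variable M : plclass.
Hypotheses (univ : universal_class M) (cov : trivial_covered M)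
  (M_total : forall A, M A -> totally_ordered A)
  (M_pos : forall A, M A -> positively_pointed A).

Let I : set nat := [set i | M (pointed_int i)].
Let D (j : nat) : set nat :=
  [set d | (d %| j)%N /\ M (pointed_lex_int j d)].
Let J : set nat := [set j | D j !=set0].
Let K : set nat := [set k | M (pointed_reals SQ k)].

Lemma generators_sub (B : plgroup) : generators SQ I J K D B -> M B.
Proof.
by case=> [[i Ii ->]|[j [d [_ [_ Dd] ->]]]|[k Kk ->]].
Qed.

Lemma locally_in_generators (A : plgroup) :
  M A -> locally_in (generators SQ I J K D) A.
Proof.
move=> MA s; have total := M_total MA.
have [T [P [b [alpha [bpos ind bpt emb]]]]] :=
  ultrasimplicial_local_emb s total (M_pos MA).
have [pt0|/eqP npt] := eqVneq (plg_point A) 0.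
  (* By independence all alpha_i vanish, so any positive c_i will do. *)
  have [||h hE] := emb (pointed_int 0) (fun=> 1).
  - by move=> i _; rewrite lpos_int.
  - rewrite big1// => i iP.
    have /(_ i iP)/eqP := ind (fun i => (alpha i)%:Z) (etrans (esym bpt) pt0).
    by rewrite eqz_nat => /eqP ->.
  exists (pointed_int 0), h; split=> //; constructor 1; exists 0%N => //.
  exact: universal_int0 univ M_total cov A MA pt0.
have apos : lpos (plg_point A) by rewrite /lpos M_pos//; apply/eqP.
have nza : exists2 i, i \in P & (0 < alpha i)%N.
  apply: contrapT => noa; case: npt; rewrite bpt big1// => i iP.
  by case E : (alpha i) => //; case: noa; exists i; rewrite ?E.
have [g [beta [u [g0 gE sum1]]]] := bezout nza.
pose e := \sum_(i in P) b i *+ beta i.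
have ptE : plg_point A = e *+ g by rewrite bpt (sum_mulrn_factor _ gE).
have epos : lpos e by apply: (lposMn_inv total (n := g)); rewrite -ptE.
have [dens|ndens] := pselect (dense_point (plg_point A)).
  have [c cpos cE] := dense_at_solve (@pointed_reals_total R S SQ 1)
    (lpos_one SQ) (dense_at_one S_dense SQ) sum1.
  have [|h hE] := emb (pointed_reals SQ g) c cpos.
    by rewrite (sum_mulrn_factor _ gE) cE [RHS]pointed_reals_point.
  exists (pointed_reals SQ g), h; split=> //; constructor 3; exists g => //.
  apply: (universal_class_embedding univ MA) => s'.
  exact: pointed_reals_emb ptE dens.
have [M0 discrete] : exists M0, forall (x : A) (m : nat), lpos x ->
    lle (plg_point A) (x *+ m) -> lle (plg_point A) (x *+ M0).
  move: ndens => /existsNP[M0 nd]; exists M0 => x m xpos xm.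
  apply: contrapT => nx; apply: nd; exists x, m; split=> //.
  apply: contrapT => /negP/(lposPn total).
  by rewrite -lle_subr sub0r opprB lle_subr.
have [p pP ap] := nza.
have [[q [qP qp aq]]|noq] :=
  pselect (exists q, [/\ q \in P, q != p & (0 < alpha q)%N]); last first.
  have a0 i : i \in P -> i != p -> alpha i = 0%N.
    by move=> iP ip; case E : (alpha i) => //; case: noq; exists i; rewrite E.
  have [||h hE] := emb (pointed_int (alpha p)) (fun=> 1).
  - by move=> i _; rewrite lpos_int.
  - rewrite (bigD1 p)//= big1 ?addr0 ?natz// => i /andP[iP ip].
    by rewrite a0.
  exists (pointed_int (alpha p)), h; split=> //; constructor 1.
  exists (alpha p) => //; apply: (universal_class_embedding univ MA) => s'.
  apply: (pointed_int_emb s' (bpos p pP)).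
  by rewrite bpt (bigD1 p)//= big1 ?addr0// => i /andP[iP ip]; rewrite a0.
pose inf := infinitesimal (plg_point A).
have [v [vpos vninf vmin]] := unit_exists total apos discrete.
(* Only indices with alpha_i > 0 satisfy b_i <= a and can be compared with v; for the others m_i is
   an arbitrary positive number. *)
have /boolp.choice[m mP] (i : T) : exists m : nat,
    if (0 < alpha i)%N && (i \in P) then inf (b i - v *+ m) else (0 < m)%N.
  case: (boolP ((0 < alpha i)%N && (i \in P))); last by exists 1%N.
  move=> /andP[ai iP].
  apply: (nearest_multiple total apos discrete vpos vninf vmin (bpos i iP)).
  rewrite bpt (bigD1 i)//= -(prednK ai) mulrS -addrA -{1}[b i]addr0 lle_D2l.
  apply: lnnegD; first exact/lnnegMn/lposW/bpos.
  elim/big_ind: _ => [||k /andP[kP _]]; [exact: lle_refl|exact: lnnegD|].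
  exact/lnnegMn/lposW/bpos.
have minf i : i \in P -> (0 < alpha i)%N -> inf (b i - v *+ m i).
  by move=> iP ai; have := mP i; rewrite ai iP.
pose j' := (\sum_(i in P) beta i * m i)%N.
have einf : inf (e - v *+ j').
  have -> : e - v *+ j' = \sum_(i in P) (b i - v *+ m i) *+ beta i.
    rewrite /e /j' -sumrMnr -sumrB; apply: eq_bigr => i _; zmodule.
  apply: infinitesimal_sum => // i iP; have [b0|bi] := posnP (beta i).
    by rewrite b0; apply: infinitesimal0.
  by apply/infinitesimalMn/minf; rewrite // gE// muln_gt0 bi.
have j'0 : (0 < j')%N.
  rewrite lt0n; apply/eqP => j'0.
  apply: (@infinitesimal_pointN A (plg_point A)).
  by rewrite [X in infinitesimal _ X]ptE; apply: infinitesimalMn;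
    move: einf; rewrite j'0 mulr0n subr0.
have [p' p'P [bp' mp']] :
    exists2 p', p' \in P & (0 < beta p')%N /\ (0 < m p')%N.
  apply: contrapT => nop; move: j'0; rewrite /j' big1// => i iP.
  apply/eqP; rewrite muln_eq0 !eqn0Ngt -negb_and; apply/negP => /andP[bi mi].
  by apply: nop; exists i.
(* If m_p = 0, b_p itself is infinitesimal. Otherwise m_p b_q - m_q b_p cancels the multiples of v,
   and it is nonzero by independence; its sign is adjusted. *)
have [w wpos winf] : exists2 w, lpos w & inf w.
  have [mp0|mp0] := posnP (m p).
    exists (b p); first exact: bpos.
    by move: (minf p pP ap); rewrite mp0 mulr0n subr0.
  pose w := b q *+ m p - b p *+ m q.
  have winf : inf w.
    have -> : w = (b q - v *+ m q) *+ m p + - ((b p - v *+ m p) *+ m q).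
      by rewrite /w; zmodule.
    by apply: infinitesimalD => //; [|apply: infinitesimalN];
      apply: infinitesimalMn; apply: minf.
  have [w0|wpos|wpos] := lpos_trichotomy total w; [|by exists w|]; last first.
    by exists (- w) => //; apply: infinitesimalN.
  pose kappa i : int :=
    if i == q then (m p)%:Z else if i == p then - (m q)%:Z else 0.
  have /(_ q qP) : forall i, i \in P -> kappa i = 0.
    apply: ind; rewrite /relation (bigD1 q)//= (bigD1 p)/=; last first.
      by rewrite pP eq_sym.
    rewrite big1 => [|i /andP[/andP[_ /negPf iq] /negPf ip]]; last first.
      by rewrite /kappa iq ip mulr0z.
    rewrite /kappa !eqxx [p == q]eq_sym (negPf qp) addr0 -[RHS]w0 /w; zmodule.
  by rewrite /kappa eqxx => /eqP; rewrite eqz_nat eqn0Ngt mp0.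
have [x [eps [xinf epspos epsinf eE]]] :=
  unit_adjust total apos j'0 einf wpos winf.
have [r sumr rpos] := lex_solve sum1 p'P bp' mp'.
(* The vectors (m_i, r_i) combine with the beta_i to (j', 1), hence with the alpha_i to (j, g).
   Correspondingly a = g (j' x + eps) = j x + g eps in A. *)
pose j := (j' * g)%N.
have [|h hE] := emb (pointed_lex_int j g) _ rpos.
  rewrite (sum_mulrn_factor _ gE) lex_int_sum sumr.
  have -> : \sum_(i in P) (m i)%:Z *+ beta i = j'%:Z.
    rewrite /j' (big_morph Posz PoszD (erefl _)).
    by apply: eq_bigr => i _; rewrite PoszM pmulrn mulrzz mulrC.
  by rewrite lex_int_mulrn pmulrn mulrzz -PoszM natz.
exists (pointed_lex_int j g), h; split=> //; constructor 2.
have Dg : D j g.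
  split; first exact: dvdn_mull.
  apply: (universal_class_embedding univ MA) => s'.
  exists (fun y : lex int int => x *~ y.1 + eps *~ y.2).
  apply: morphism_local_emb; first exact: pointed_lex_int_total.
  - by move=> y y'; rewrite !mulrzDr addrACA.
  - by rewrite ptE eE /= /j; zmodule.
  - move=> y; rewrite lpos_lex_int => y0.
    exact: (lex_positive total apos discrete vpos vninf xinf).
by exists j, g; split=> //; exists g.
Qed.

End Generators.
End PointedRealsEmbedding.

Theorem theorem6p6 (R : realType) (S : lsubgroup R)
  (S_fg : finitely_generated S) (S_dense : dense (S : set R))
  (SQ : (S : set R) `&` range (@ratr R) = range (fun z : int => z%:~R))
  (M : plclass)
  (M_total : forall A, M A -> totally_ordered A)
  (M_pos : forall A, M A -> positively_pointed A) :
  (universal_class M /\ trivial_covered M) <->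
  (exists (I J K : set nat) (D : nat -> set nat),
    (forall j, J j -> D j !=set0 /\ forall d, D j d -> (d %| j)%N) /\
    forall A, M A <-> ISPU (generators SQ I J K D) A).
Proof.
split=> [[univ cov]|[I [J [K [D [_ MI]]]]]].
  pose D j := [set d | (d %| j)%N /\ M (pointed_lex_int j d)].
  exists [set i | M (pointed_int i)], [set j | D j !=set0],
    [set k | M (pointed_reals SQ k)], D; split=> [j Jj|A].
    by split=> // d [].
  split=> [MA|/ISPU_locally_in locA].
    apply: locally_in_ISPU.
    exact: (locally_in_generators S_dense SQ univ cov M_total M_pos MA).
  apply: (universal_class_locally_in univ) => s.
  have [B [h [genB hE]]] := locA s.
  by exists B, h; split=> //; apply: generators_sub genB.
have ME A : M A <-> locally_in (generators SQ I J K D) A.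
  split=> [/MI/ISPU_locally_in//|locA]; exact/MI/locally_in_ISPU.
split.
  have [Sigma SigmaP] := locally_in_universal (generators SQ I J K D).
  by exists Sigma => A; rewrite ME.
(* Even on the empty list a local embedding preserves 0 and the point, so some generator is pointed
   at 0; generators are nontrivial. *)
move=> [A MA triv]; have [B [h [genB [[h0 hp _] _ _ _ _]]]] := (ME A).1 MA [::].
exists B; split.
- by apply/ME => s; exists B, id; split=> //; split=> //; split=> // x y.
- case: genB => [[i _ ->]|[j [d [_ _ ->]]]|[k _ ->]].
  + by move=> /(_ 1%Z).
  + by move=> /(_ ((1, 0) : lex int int)).
  + move=> /(_ (plg_point (pointed_reals SQ 1))) e.
    by have := lpos_one SQ; rewrite /lpos e eqxx andbF.
- by rewrite -hp (triv (plg_point A)) h0.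
Qed.
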